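(* For $\beta<1$, consider on the Euclidean motion group $M(2)$ the square integrable and compactly supported function $f_\beta(z,e^{i\varphi})=\chi_{B_1(0)}(z)\frac{1}{|z|^\beta}$. Then for every $1<q<2$ there exists $\beta\in(\frac23,1)$ such that $$\int_0^\infty\|\hat f_\beta(a)\|_{S_q}^q\,a\,da=\infty.$$
   Context: $M(2)$ is the semidirect product of $\mathbb R^2\cong\mathbb C$ with $SO(2)$; its elements are written $(z,e^{i\varphi})$ with $z\in\mathbb C$, $\varphi\in\mathbb R$, and its Haar measure is $dz\,d\varphi$ ($dz$ Lebesgue measure on $\mathbb C$, $d\varphi$ Haar measure on the circle, i.e. $d\varphi$ on $[-\pi,\pi)$). $B_1(0)$ is the unit ball of $\mathbb C$ centred at $0$ and $\chi$ denotes the indicator function. For $a>0$, $\pi_a(z,e^{i\varphi})$ is the unitary operator on $L^2(S^1)$ given by $$\pi_a(z,e^{i\varphi})g(\theta)=e^{i\,\mathrm{Re}(ae^{i\theta}z)}g(\theta-\varphi),\qquad g\in L^2(S^1).$$ For $f\in L^1(M(2))$, the group Fourier transform is the bounded operator on $L^2(S^1)$ given by $\hat f(a)=\int_{M(2)}f(z,e^{i\varphi})\pi_a(z,e^{i\varphi})\,dz\,d\varphi$. $S_q$ is the $q$-Schatten class with $\|T\|_{S_q}^q=\mathrm{tr}(T^*T)^{q/2}$ (taken to be $\infty$ if $T\notin S_q$). *)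

(* Defs.v *)
From HB Require Import structures.
From mathcomp Require Import all_boot all_order all_algebra generic_quotient.
From mathcomp Require Import complex.
From mathcomp Require Import all_classical all_reals all_analysis.
From mathcomp Require Import measurable_realfun.
From mathcomp Require Import lra.

Set Implicit Arguments.
Unset Strict Implicit.
Unset Printing Implicit Defensive.

Import Order.TTheory GRing.Theory Num.Theory.
Import numFieldNormedType.Exports.
Import ComplexField.

Local Open Scope classical_set_scope.
Local Open Scope ring_scope.
Local Open Scope complex_scope.

Definition cabs (R : realType) (z : R[i]) : R := Normc.normc z.

Section ComplexIntegration.
Context d (T : measurableType d) (R : realType).
Variables (mu : {measure set T -> \bar R}) (D : set T).

Definition cintegral (f : T -> R[i]) : R[i] :=
  Complex (\int[mu]_(x in D) complex.Re (f x))%R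
          (\int[mu]_(x in D) complex.Im (f x))%R.

Definition square_integrable_on (f : T -> R[i]) : Prop :=
  [/\ measurable_fun D (fun x => complex.Re (f x)),
      measurable_fun D (fun x => complex.Im (f x)) &
      (\int[mu]_(x in D) ((cabs (f x)) ^+ 2)%:E < +oo)%E].

Let normc2 (z : R[i]) :
  cabs z ^+ 2 = complex.Re z ^+ 2 + complex.Im z ^+ 2.
Proof. by case: z => x y; rewrite /cabs /= sqr_sqrtr// addr_ge0// sqr_ge0. Qed.

Let Re1 (a u w : R[i]) : complex.Re (a * u + w) =
  complex.Re a * complex.Re u - complex.Im a * complex.Im u + complex.Re w.
Proof. by case: a u w => [a1 a2] [x1 x2] [y1 y2]. Qed.

Let Im1 (a u w : R[i]) : complex.Im (a * u + w) =
  complex.Re a * complex.Im u + complex.Im a * complex.Re u + complex.Im w.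
Proof. by case: a u w => [a1 a2] [x1 x2] [y1 y2]. Qed.

Let measurable_normc2 (f : T -> R[i]) : measurable D ->
  measurable_fun D (fun x => complex.Re (f x)) ->
  measurable_fun D (fun x => complex.Im (f x)) ->
  measurable_fun D (EFin \o (fun x => cabs (f x) ^+ 2)).
Proof.
move=> mD mr mi; apply/measurable_EFinP.
under eq_fun do rewrite normc2.
by apply: measurable_funD; apply: measurable_funX.
Qed.

Lemma square_integrable_on0 : square_integrable_on (fun=> 0).
Proof.
split; [exact: measurable_cst..|].
by rewrite integral0_eq ?ltry// => x _; rewrite normc2 expr0n addr0.
Qed.

Lemma square_integrable_onZD (a : R[i]) (f g : T -> R[i]) :
  measurable D -> square_integrable_on f -> square_integrable_on g ->
  square_integrable_on (fun x => a * f x + g x).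
Proof.
move=> mD [fr fi fo] [gr gi go].
have mr : measurable_fun D (fun x => complex.Re (a * f x + g x)).
  under eq_fun do rewrite Re1.
  apply: measurable_funD => //; apply: measurable_funB;
    by apply: measurable_funM => //; exact: measurable_cst.
have mi : measurable_fun D (fun x => complex.Im (a * f x + g x)).
  under eq_fun do rewrite Im1.
  apply: measurable_funD => //; apply: measurable_funD;
    by apply: measurable_funM => //; exact: measurable_cst.
split=> //.
pose k := 2 * cabs a ^+ 2.
have k0 : 0 <= k by rewrite mulr_ge0// sqr_ge0.
apply: (@le_lt_trans _ _ (\int[mu]_(x in D)
  (k%:E * (cabs (f x) ^+ 2)%:E + 2%:E * (cabs (g x) ^+ 2)%:E))%E).
  apply: ge0_le_integral => //.
  - by move=> x _; rewrite lee_fin sqr_ge0.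
  - exact: measurable_normc2.
  - by apply: emeasurable_funD; apply: measurable_funeM;
      exact: measurable_normc2.
  - move=> x _; rewrite -!EFinM -EFinD lee_fin /k !normc2 Re1 Im1.
    set p := complex.Re a; set q := complex.Im a.
    set u := complex.Re (f x); set v := complex.Im (f x).
    set s := complex.Re (g x); set t := complex.Im (g x).
    have := sqr_ge0 (p * u - q * v - s); have := sqr_ge0 (p * v + q * u - t).
    nra.
rewrite ge0_integralD//.
- rewrite !ge0_integralZl//; last 4 first.
  + exact: measurable_normc2.
  + by move=> x _; rewrite lee_fin sqr_ge0.
  + exact: measurable_normc2.
  + by move=> x _; rewrite lee_fin sqr_ge0.
  by rewrite lte_add_pinfty// lte_mul_pinfty// ?lee_fin.
- by move=> x _; rewrite -EFinM lee_fin mulr_ge0// sqr_ge0.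
- by apply: measurable_funeM; exact: measurable_normc2.
- by move=> x _; rewrite -EFinM lee_fin mulr_ge0// sqr_ge0.
- by apply: measurable_funeM; exact: measurable_normc2.
Qed.

End ComplexIntegration.

(* [ip] is meant to be the inner product of a Hilbert space, linear in its first
   argument. *)

Section Operators.
Context (R : realType) (V : lmodType R[i]) (ip : V -> V -> R[i]).

Definition hnorm (v : V) : R := Num.sqrt (complex.Re (ip v v)).

Definition bounded_op (T : V -> V) : Prop :=
  linear T /\ exists M : R, forall v, hnorm (T v) <= M * hnorm v.

Definition opnorm (T : V -> V) : R :=
  inf [set M : R | 0 <= M /\ forall v, hnorm (T v) <= M * hnorm v].

Definition adjoint (T : V -> V) : V -> V :=
  xget (fun=> 0)
    [set S | bounded_op S /\ forall u v, ip (T u) v = ip u (S v)].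

Definition op_horner (p : {poly R}) (A : V -> V) (v : V) : V :=
  \sum_(k < size p) (p`_k)%:C *: iter k A v.

(* Continuous functional calculus, for [A] positive and [0 < s]: since the
   spectrum of [A] lies in [0, opnorm A], A^s is the norm limit of p_n(A) for
   any polynomials p_n converging to x^s uniformly on that interval. *)
Definition op_powR (A : V -> V) (s : R) : V -> V :=
  xget (fun=> 0)
    [set B | bounded_op B /\
       exists p : nat -> {poly R},
         (forall e : R, 0 < e -> \forall n \near \oo,
            forall x : R, 0 <= x <= opnorm A -> `|(p n).[x] - x `^ s| < e) /\
         (fun n => opnorm (fun v => op_horner (p n) A v - B v)) @ \oo --> 0 ].

(* [e] is meant to be an orthonormal basis and [B] a positive operator; the sum
   does not depend on the choice of [e]. *)
Definition op_trace (I : choiceType) (e : I -> V) (B : V -> V) : \bar R :=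
  (\esum_(i in [set: I]) (complex.Re (ip (B (e i)) (e i)))%:E)%E.

(* The q-th power of the q-Schatten norm, tr (T^* T)^(q/2); it is +oo exactly
   when the bounded operator [T] is not in the Schatten class. *)
Definition schatten_norm_pow (I : choiceType) (e : I -> V) (q : R)
    (T : V -> V) : \bar R :=
  op_trace e (op_powR (adjoint T \o T) (q / 2)).

End Operators.

Section Circle.
Context (R : realType).

Definition unit_circle : set R[i]^o := [set w | `|w| = 1].

Definition cval (w : unit_circle) : R[i] := val w.

Lemma cval_norm (w : unit_circle) : `|cval w| = 1.
Proof. exact: (set_mem (valP w)). Qed.

Lemma cis_subproof (t : R) : Complex (cos t) (sin t) \in unit_circle.
Proof.
by apply/mem_set; rewrite /unit_circle/= normc_def/= cos2Dsin2 sqrtr1.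
Qed.

Definition cis (t : R) : unit_circle :=
  exist (fun z => z \in unit_circle) _ (cis_subproof t).

Lemma circle_div_subproof (x w : unit_circle) :
  cval x / cval w \in unit_circle.
Proof.
apply/mem_set; rewrite /unit_circle/=.
by rewrite normrM normfV !cval_norm divr1.
Qed.

Definition circle_div (x w : unit_circle) : unit_circle :=
  exist (fun z => z \in unit_circle) _ (circle_div_subproof x w).

Definition circle_arc : set R := `[- pi, pi[.

Definition L2fun_pred : {pred unit_circle -> R[i]^o} := fun g =>
  `[< square_integrable_on lebesgue_measure circle_arc (fun t => g (cis t)) >].

Lemma L2fun_submod_closed : submod_closed L2fun_pred.
Proof.
split; first by apply/asboolP; exact: square_integrable_on0.
move=> a f g /asboolP fL /asboolP gL; apply/asboolP.
by apply: square_integrable_onZD => //; exact: measurable_itv.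
Qed.

HB.instance Definition _ :=
  GRing.isSubmodClosed.Build _ _ L2fun_pred L2fun_submod_closed.

Record L2fun := MkL2fun
  { L2fun_val :> unit_circle -> R[i]^o ; _ : L2fun_val \in L2fun_pred }.
HB.instance Definition _ := [isSub for L2fun_val].
HB.instance Definition _ := [Choice of L2fun by <:].
HB.instance Definition _ := [SubChoice_isSubLmodule of L2fun by <:].

Lemma L2fun_addE (f g : L2fun) x : (f + g) x = f x + g x.
Proof. by []. Qed.

Lemma L2fun_oppE (f : L2fun) x : (- f) x = - f x.
Proof. by []. Qed.

Lemma L2fun_scaleE a (f : L2fun) x : (a *: f) x = a * f x.
Proof. by []. Qed.

Definition ae_equal (f g : L2fun) : bool :=
  `[< {ae lebesgue_measure, forall t : R, circle_arc t ->
         f (cis t) = g (cis t)} >].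

Let ae_filter : Filter (almost_everywhere (@lebesgue_measure R)).
Proof. exact: (ae_filter_ringOfSetsType (@lebesgue_measure R)). Qed.
#[local] Existing Instance ae_filter.

Lemma ae_equal_refl : reflexive ae_equal.
Proof. by move=> f; apply/asboolP; exact: aeW. Qed.

Lemma ae_equal_sym : symmetric ae_equal.
Proof.
move=> f g; apply/idP/idP => /asboolP fg; apply/asboolP;
  by apply: filterS fg => t fg /fg.
Qed.

Lemma ae_equal_trans : transitive ae_equal.
Proof.
move=> g f h /asboolP fg /asboolP gh; apply/asboolP.
by apply: filterS2 fg gh => t fg gh Dt; rewrite fg// gh.
Qed.

Canonical ae_equal_equiv :=
  EquivRel ae_equal ae_equal_refl ae_equal_sym ae_equal_trans.

Local Open Scope quotient_scope.

Definition L2S1 : Type := {eq_quot ae_equal}.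
HB.instance Definition _ := Choice.on L2S1.
HB.instance Definition _ := EqQuotient.on L2S1.

Definition L2_add (u v : L2S1) : L2S1 := \pi_L2S1 (repr u + repr v).
Definition L2_opp (u : L2S1) : L2S1 := \pi_L2S1 (- repr u).
Definition L2_scale (a : R[i]) (u : L2S1) : L2S1 := \pi_L2S1 (a *: repr u).

Lemma L2_eqP (f g : L2fun) : \pi_L2S1 f = \pi_L2S1 g <->
  {ae lebesgue_measure, forall t : R, circle_arc t -> f (cis t) = g (cis t)}.
Proof.
split=> [/eqP|fg]; first by rewrite eqmodE => /asboolP.
by apply/eqP; rewrite eqmodE; apply/asboolP.
Qed.

Lemma L2_reprP (f : L2fun) : {ae lebesgue_measure, forall t : R,
  circle_arc t -> repr (\pi_L2S1 f) (cis t) = f (cis t)}.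
Proof. by apply/L2_eqP; rewrite reprK. Qed.

Lemma pi_L2D (f g : L2fun) :
  L2_add (\pi_L2S1 f) (\pi_L2S1 g) = \pi_L2S1 (f + g).
Proof.
apply/L2_eqP; apply: filterS2 (L2_reprP f) (L2_reprP g) => t ff gg Dt.
by rewrite !L2fun_addE ff// gg.
Qed.

Lemma pi_L2N (f : L2fun) : L2_opp (\pi_L2S1 f) = \pi_L2S1 (- f).
Proof.
apply/L2_eqP; apply: filterS (L2_reprP f) => t ff Dt.
by rewrite !L2fun_oppE ff.
Qed.

Lemma pi_L2Z a (f : L2fun) : L2_scale a (\pi_L2S1 f) = \pi_L2S1 (a *: f).
Proof.
apply/L2_eqP; apply: filterS (L2_reprP f) => t ff Dt.
by rewrite !L2fun_scaleE ff.
Qed.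

Lemma L2_addA : associative L2_add.
Proof.
elim/quotW=> f; elim/quotW=> g; elim/quotW=> h.
rewrite (pi_L2D g h) (pi_L2D f g) (pi_L2D f (g + h)) (pi_L2D (f + g) h).
by rewrite addrA.
Qed.

Lemma L2_addC : commutative L2_add.
Proof.
by elim/quotW=> f; elim/quotW=> g; rewrite (pi_L2D f g) (pi_L2D g f) addrC.
Qed.

Lemma L2_add0 : left_id (\pi_L2S1 0) L2_add.
Proof. by elim/quotW=> f; rewrite (pi_L2D 0 f) add0r. Qed.

Lemma L2_addN : left_inverse (\pi_L2S1 0) L2_opp L2_add.
Proof. by move=> u; rewrite -[u]reprK pi_L2N pi_L2D addNr. Qed.

HB.instance Definition _ :=
  GRing.isZmodule.Build L2S1 L2_addA L2_addC L2_add0 L2_addN.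

Lemma L2_scaleA a b (u : L2S1) :
  L2_scale a (L2_scale b u) = L2_scale (a * b) u.
Proof.
elim/quotW: u => f; rewrite (pi_L2Z b f) (pi_L2Z a) (pi_L2Z (a * b) f).
by rewrite scalerA.
Qed.

Lemma L2_scale1 : left_id 1 L2_scale.
Proof. by elim/quotW=> f; rewrite (pi_L2Z 1 f) scale1r. Qed.

Lemma L2_scaleDr : right_distributive L2_scale +%R.
Proof.
move=> a; elim/quotW=> f; elim/quotW=> g; rewrite -[_ + _]/(L2_add _ _).
rewrite -[RHS]/(L2_add _ _) (pi_L2D f g) (pi_L2Z a (f + g)) (pi_L2Z a f).
by rewrite (pi_L2Z a g) (pi_L2D (a *: f) (a *: g)) scalerDr.
Qed.

Lemma L2_scaleDl u : {morph L2_scale^~ u : a b / a + b}.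
Proof.
elim/quotW: u => f a b; rewrite (pi_L2Z (a + b) f) -[RHS]/(L2_add _ _).
by rewrite (pi_L2Z a f) (pi_L2Z b f) (pi_L2D (a *: f) (b *: f)) scalerDl.
Qed.

HB.instance Definition _ := GRing.Zmodule_isLmodule.Build R[i] L2S1
  L2_scaleA L2_scale1 L2_scaleDr L2_scaleDl.

(* The class of [g], or 0 when [g] is not square integrable. *)
Definition L2_class (g : unit_circle -> R[i]) : L2S1 :=
  \pi_L2S1 (insubd (0 : L2fun) (g : unit_circle -> R[i]^o)).

Definition L2_ip (u v : L2S1) : R[i] :=
  cintegral lebesgue_measure circle_arc
    (fun t => repr u (cis t) * (repr v (cis t))^*).

(* The orthonormal basis e^(int) / sqrt (2 pi), n in Z. *)
Definition fourier_basis (n : int) : L2S1 :=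
  L2_class (fun x => (Num.sqrt (2 * pi))^-1%:C * cval x ^ n).

End Circle.

Arguments unit_circle : clear implicits.
Arguments circle_arc : clear implicits.

Section MotionGroup.
Context (R : realType).

(* [(z, w)] stands for (z, e^(i phi)) with w = e^(i phi). *)
Definition M2 : Type := (R[i]^o * unit_circle R)%type.

(* Haar measure is dz dphi in the coordinates z = x + iy, phi in [-pi, pi). *)
Definition M2_coord (p : (measurableTypeR R * measurableTypeR R)
    * measurableTypeR R) : M2 :=
  (Complex p.1.1 p.1.2, cis p.2).

Definition M2_measure :=
  (@lebesgue_measure R \x @lebesgue_measure R \x @lebesgue_measure R)%E.

Definition M2_chart : set ((measurableTypeR R * measurableTypeR R)
    * measurableTypeR R) := setT `*` circle_arc R.

Definition M2_integral (f : M2 -> R[i]) : R[i] :=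
  cintegral M2_measure M2_chart (fun p => f (M2_coord p)).

Definition M2_square_integrable (f : M2 -> R[i]) : Prop :=
  square_integrable_on M2_measure M2_chart (fun p => f (M2_coord p)).

Definition compactly_supported (f : M2 -> R[i]) : Prop :=
  compact (closure [set m | f m != 0]).

(* With x = e^(i theta) and m.2 = e^(i phi), [circle_div x m.2] is
   e^(i (theta - phi)). *)
Definition M2_rep (a : R) (m : M2) (g : L2S1 R) : L2S1 R :=
  L2_class (fun x =>
    cval (cis (complex.Re (a%:C * cval x * m.1))) * repr g (circle_div x m.2)).

(* The operator-valued integral of [f m] times [M2_rep a m], in the weak
   sense. *)
Definition M2_fourier (f : M2 -> R[i]) (a : R) : L2S1 R -> L2S1 R :=
  xget (fun=> 0)
    [set T | bounded_op (@L2_ip R) T /\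
       forall g h : L2S1 R,
         L2_ip (T g) h = M2_integral (fun m => f m * L2_ip (M2_rep a m g) h)].

Definition M2_schatten_pow (q : R) (T : L2S1 R -> L2S1 R) : \bar R :=
  schatten_norm_pow (@L2_ip R) (@fourier_basis R) q T.

Definition f_beta (beta : R) : M2 -> R[i] := fun m =>
  (\1_(ball (0 : R[i]^o) 1) m.1 * (1 / cabs m.1 `^ beta))%:C.

End MotionGroup.

(* Main.v *)
Require Import Defs.
From HB Require Import structures.
From mathcomp Require Import all_boot all_order all_algebra.
From mathcomp Require Import complex.
From mathcomp Require Import all_classical all_reals all_analysis measurable_realfun.
From mathcomp Require Import ring lra.

(** Why the integral diverges.  The function f = f_beta ignores the rotation,
so integrating f against pi_a over the rotations first replaces g by its
integral: f^(a) g = (int g) F_a, where F_a is a plane Fourier transform of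
the weight |z|^-beta on the unit disc, restricted to the circle of radius a.
Hence f^(a) has rank at most one.  If T u = <u, e> w with e a unit vector, the Gram
operator of T (adjoint composed with T) is |w|^2 times the projection on e, and
the q-th power of the Schatten norm is |w|^q.  For f^(a) the vector e is the
normalized constant, and <w, e> is the integral of F_a over the circle, whose
real part is called G(a) below.  So the integrand is at least |G(a)|^q a
([schatten_ge_mean], [mean_fourier_le_schatten]).

Since G(a) is an integral of |z|^-beta against a Bessel function, it decays
like a^(beta-2), plus an oscillating part of order a^(-3/2) coming from the
sharp edge of the disc.  No such expansion is used.  Instead G is tested
against the damped density a e^(-tau a) as tau tends to 0, which averages the
oscillation away.  Exchanging integrals,
  int_0^oo G(a) a e^(-tau a) da = int |z|^-beta Phi_tau(z) dz,
where Phi_tau(z) is the integral over the directions t of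
K(s) = (tau^2 - s^2) / (tau^2 + s^2)^2 at s = Re (e^(it) z), K being the Laplace
transform of a cos (a s).  Although K changes sign, Phi_tau is nonnegative
([abel_arc_ge0]), and it is at least tau^-2 for |z| <= tau / 2 ([abel_arc_ge]).
Keeping only a square of side tau / 4 gives the lower bound tau^-beta / 16
([integral_damped_ge]).

In the other direction, G <= lam + lam^(1-q) |G|^q for every lam > 0, so the
same damped integral is at most lam tau^-2 + lam^(1-q) I, where I is the
integral of the theorem ([damped_mean_le]).  The choice lam = tau^(2/q) makes
this (1 + I) tau^(2/q - 2).  If I were finite, tau^-beta would be at most
16 (1 + I) tau^(2/q - 2) for all small tau, which is absurd once
beta > 2 - 2/q ([schatten_integral_infty]).  Such a beta < 1 exists exactly
because q < 2.

Fractional powers of the Gram operator are norm limits of polynomials that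
converge uniformly to x^(q/2).  The Bernstein part supplies such polynomials,
and for a rank-one Gram operator the limit is explicit.  Square integrability
of f_beta for beta < 1 is read off a covering of the disc by dyadic squares.
*)

Set Implicit Arguments.
Unset Strict Implicit.
Unset Printing Implicit Defensive.

Import Order.TTheory GRing.Theory Num.Theory.
Import numFieldNormedType.Exports.

Local Open Scope classical_set_scope.
Local Open Scope ring_scope.
Local Open Scope complex_scope.

(** * Complex numbers *)

Section ComplexNumbers.
Context {R : realType}.
Implicit Types x y : R[i].

Lemma conjM x y : Num.conj (x * y) = Num.conj x * Num.conj y.
Proof. exact: rmorphM. Qed.

Lemma conj_real (a : R) : Num.conj (a%:C : R[i]) = a%:C.
Proof. exact: conjc_real. Qed.

Lemma realCM (a b : R) : (a * b)%:C = a%:C * b%:C :> R[i].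
Proof. exact: rmorphM. Qed.

Lemma realC_sum n (f : 'I_n -> R) : (\sum_(k < n) f k)%:C = \sum_(k < n) (f k)%:C :> R[i].
Proof. exact: rmorph_sum. Qed.

Lemma cabs_ge0 (z : R[i]) : 0 <= cabs z.
Proof. by case: z => a b; exact: sqrtr_ge0. Qed.

Lemma cabs_sqr (z : R[i]) : cabs z ^+ 2 = complex.Re z ^+ 2 + complex.Im z ^+ 2.
Proof. by case: z => x y; rewrite /cabs /= sqr_sqrtr// addr_ge0// sqr_ge0. Qed.

Lemma mulCJ (z : R[i]) : z * Num.conj z = (cabs z ^+ 2)%:C.
Proof.
rewrite cabs_sqr; case: z => x y /=.
by apply/eqP; rewrite eq_complex /=; apply/andP; split; apply/eqP; ring.
Qed.

Lemma Re_le_cabs (z : R[i]) : `|complex.Re z| <= cabs z.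
Proof.
rewrite -(@ler_pXn2r _ 2) ?nnegrE ?cabs_ge0// real_normK ?num_real// cabs_sqr.
by rewrite lerDl sqr_ge0.
Qed.

Lemma cabs_real (x : R) : cabs x%:C = `|x|.
Proof. by rewrite /cabs /= expr0n addr0 sqrtr_sqr. Qed.

Lemma cabsM (x y : R[i]) : cabs (x * y) = cabs x * cabs y.
Proof. exact: Normc.normcM. Qed.

Lemma ReM (x y : R[i]) : complex.Re (x * y) =
  complex.Re x * complex.Re y - complex.Im x * complex.Im y.
Proof. by case: x y => [? ?] [? ?]. Qed.

Lemma ImM (x y : R[i]) : complex.Im (x * y) =
  complex.Re x * complex.Im y + complex.Im x * complex.Re y.
Proof. by case: x y => [? ?] [? ?]. Qed.

Lemma ReD (x y : R[i]) : complex.Re (x + y) = complex.Re x + complex.Re y.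
Proof. by case: x y => [? ?] [? ?]. Qed.

Lemma ImD (x y : R[i]) : complex.Im (x + y) = complex.Im x + complex.Im y.
Proof. by case: x y => [? ?] [? ?]. Qed.

Lemma ReJ (x : R[i]) : complex.Re (Num.conj x) = complex.Re x.
Proof. by case: x. Qed.

Lemma ImJ (x : R[i]) : complex.Im (Num.conj x) = - complex.Im x.
Proof. by case: x. Qed.

Lemma cabsJ x : cabs (Num.conj x) = cabs x.
Proof. by case: x => a b; rewrite /cabs/= sqrrN. Qed.

Lemma cabsE (x : R[i]) : cabs x = Num.sqrt (complex.Re x ^+ 2 + complex.Im x ^+ 2).
Proof. by case: x. Qed.

Lemma Im_le_cabs (z : R[i]) : `|complex.Im z| <= cabs z.
Proof.
rewrite -(@ler_pXn2r _ 2) ?nnegrE ?cabs_ge0// real_normK ?num_real// cabs_sqr.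
by rewrite lerDr sqr_ge0.
Qed.

Lemma cabs_le_ReIm (z : R[i]) : cabs z <= `|complex.Re z| + `|complex.Im z|.
Proof.
rewrite -(@ler_pXn2r _ 2) ?nnegrE ?cabs_ge0 ?addr_ge0// cabs_sqr sqrrD.
rewrite !real_normK ?num_real//.
have := normr_ge0 (complex.Re z); have := normr_ge0 (complex.Im z); nra.
Qed.

Lemma Re_realM (a : R) (x : R[i]) : complex.Re (a%:C * x) = a * complex.Re x.
Proof. by rewrite ReM /= mul0r subr0. Qed.

Lemma Im_realM (a : R) (x : R[i]) : complex.Im (a%:C * x) = a * complex.Im x.
Proof. by rewrite ImM /= mul0r addr0. Qed.

Lemma normCE (z : R[i]) : `|z| = (cabs z)%:C.
Proof. by rewrite normc_def cabsE. Qed.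

End ComplexNumbers.

(** * Polynomial approximation of real powers *)

Section Bernstein.
Context {R : realType}.

(** The Bernstein polynomial, as the mean of [h] over the number of heads in
[n] tosses of a coin of bias 'X, conditioned on one of the tosses. *)
Fixpoint bernstein (n : nat) (h : nat -> R) : {poly R} :=
  if n is m.+1 then 'X * bernstein m (h \o succn) + (1 - 'X) * bernstein m h
  else (h 0%N)%:P.

(** Chebyshev's inequality in disguise: the expression multiplied by [B] is the
second moment about [d] of a binomial variable, so the claim is monotonicity of
the mean.  Keeping [d] free lets a single induction on the number of tosses do
the work, since conditioning on heads shifts [d] by one. *)
Lemma bernstein_near (n : nat) (h : nat -> R) (c d A B x : R) : 0 <= x <= 1 ->
  (forall k, `|h k - c| <= A + B * (k%:R - d) ^+ 2) ->
  `|(bernstein n h).[x] - c| <= A + B * (n%:R * x * (1 - x) + (n%:R * x - d) ^+ 2).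
Proof.
move=> /andP[x0 x1]; elim: n h d => [|n IH] h d hk.
  by rewrite /= hornerC !mul0r add0r; have := hk 0%N.
rewrite /= !hornerE.
have h1 := IH h d hk.
have h2 : `|(bernstein n (h \o succn)).[x] - c| <=
    A + B * (n%:R * x * (1 - x) + (n%:R * x - (d - 1)) ^+ 2).
  by apply: IH => k; have := hk k.+1; rewrite /= -natr1 opprB addrCA addrA [1 + _]addrC.
set u := (bernstein n h).[x] in h1 *; set v := (bernstein n _).[x] in h2 *.
have -> : x * v + (1 - x) * u - c = x * (v - c) + (1 - x) * (u - c) by ring.
apply: (le_trans (ler_normD _ _)); rewrite !normrM (ger0_norm x0).
rewrite (@ger0_norm _ (1 - x)) ?subr_ge0//.
apply: (le_trans (lerD (ler_wpM2l x0 h2) (ler_wpM2l _ h1))); first by rewrite subr_ge0.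
rewrite -natr1 le_eqVlt; apply/orP; left; apply/eqP; ring.
Qed.

(** Subadditivity of the concave function [x `^ s]; it holds because
[c / (a + b) <= (c / (a + b)) `^ s] for [c] equal to [a] or to [b]. *)
Lemma powR_holder (s u v : R) : 0 < s <= 1 -> 0 <= u -> 0 <= v ->
  `|u `^ s - v `^ s| <= `|u - v| `^ s.
Proof.
move=> /andP[s0 s1].
have sub (a b : R) : 0 <= a -> 0 <= b -> (a + b) `^ s <= a `^ s + b `^ s.
  move=> a0 b0; have [ab0|ab0] := eqVneq (a + b) 0.
    by rewrite ab0 powR0 ?gt_eqF// addr_ge0// powR_ge0.
  have abp : 0 < a + b by rewrite lt_def ab0 addr_ge0.
  have key (c : R) : 0 <= c -> c <= a + b -> c / (a + b) * (a + b) `^ s <= c `^ s.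
    move=> c0 cab; have cE : c = c / (a + b) * (a + b) by rewrite divfK.
    have q0 : 0 <= c / (a + b) by rewrite divr_ge0// ltW.
    rewrite [in leRHS]cE powRM ?(ltW abp)//.
    apply: ler_wpM2r; first exact: powR_ge0.
    have [->|cn0] := eqVneq c 0; first by rewrite mul0r powR_ge0.
    apply: ger1_powR => //; rewrite divr_gt0// ?lt_def ?cn0//=.
    by rewrite ler_pdivrMr// mul1r.
  have := lerD (key a a0 _) (key b b0 _); rewrite -mulrDl -mulrDl divff// mul1r.
  by apply; rewrite ?lerDl ?lerDr.
wlog uv : u v / v <= u.
  move=> H u0 v0; have [/H|/ltW /H] := leP v u; first exact.
  by rewrite distrC (distrC v u); apply.
move=> u0 v0.
rewrite !ger0_norm ?subr_ge0//; last by rewrite ge0_ler_powR// ltW.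
by rewrite lerBlDr; have := sub (u - v) v; rewrite subrK subr_ge0; apply.
Qed.

(** Bernstein's proof of the Weierstrass theorem, after rescaling [0, M] to the
unit interval.  With d^s = e / 2, Hoelder continuity gives
[|u^s - x^s| <= (e / 2) (1 + (|u - x| / d)^2)], which is the quadratic majorant
that the second-moment estimate takes. *)
Lemma powR_poly_approx (s M : R) : 0 < s <= 1 -> 0 < M ->
  exists p : nat -> {poly R}, forall e : R, 0 < e -> \forall n \near \oo,
    forall x : R, 0 <= x <= M -> `|(p n).[x] - x `^ s| < e.
Proof.
move=> s01 M0; have /andP[s0 s1] := s01.
pose h (n k : nat) : R := (M * (k%:R / n.+1%:R)) `^ s.
exists (fun n => bernstein n.+1 (h n) \Po (M^-1 *: 'X)) => e e0.
pose d := (e / 2) `^ s^-1.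
have d0 : 0 < d by rewrite powR_gt0// divr_gt0.
have dsE : d `^ s = e / 2 by rewrite -powRrM mulVf ?gt_eqF// powRr1// divr_ge0// ltW.
pose N := `|Num.ceil (M ^+ 2 / d ^+ 2)|%N.
near=> n => x /andP[x0 xM].
rewrite horner_comp hornerZ hornerX.
set y := M^-1 * x.
have xE : x = M * y by rewrite /y mulVKf// gt_eqF.
have y01 : 0 <= y <= 1.
  by rewrite /y mulr_ge0 ?invr_ge0 ?(ltW M0)//= mulrC ler_pdivrMr// mul1r.
have n0 : (0 : R) < n.+1%:R by rewrite ltr0n.
apply: (@le_lt_trans _ _ (e / 2 + e / 2 * (M / (n.+1%:R * d)) ^+ 2 *
   (n.+1%:R * y * (1 - y) + (n.+1%:R * y - n.+1%:R * y) ^+ 2))).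
  apply: bernstein_near => // k.
  have kn0 : 0 <= M * (k%:R / n.+1%:R) by rewrite mulr_ge0 ?divr_ge0 ?ler0n ?ltW.
  apply: (le_trans (powR_holder s01 kn0 x0)).
  set w := `|_|; have w0 : 0 <= w by exact: normr_ge0.
  have -> : e / 2 + e / 2 * (M / (n.+1%:R * d)) ^+ 2 * (k%:R - n.+1%:R * y) ^+ 2
      = d `^ s * (1 + (w / d) ^+ 2).
    rewrite dsE mulrDr mulr1 -mulrA -exprMn; congr (_ + _ * _).
    rewrite expr_div_n /w real_normK ?num_real// -expr_div_n; congr (_ ^+ 2).
    rewrite xE; field; rewrite ?gt_eqF//.
  have [wd|dw] := leP w d.
    rewrite -[leLHS]mulr1; apply: ler_pM => //; first exact: powR_ge0.
      by apply: ge0_ler_powR => //; rewrite ?nnegrE ltW.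
    by rewrite lerDl sqr_ge0.
  (* Here [r = w / d >= 1], and [r^s <= r <= 1 + r^2]. *)
  have -> : w = d * (w / d) by field; rewrite gt_eqF.
  rewrite powRM ?divr_ge0 ?(ltW d0)//; apply: ler_wpM2l; first exact: powR_ge0.
  have wd1 : 1 <= w / d by rewrite ler_pdivlMr// mul1r ltW.
  apply: (le_trans (ler1_powR wd1 s1)).
  have -> : d * (w / d) / d = w / d by field; rewrite gt_eqF.
  nra.
have [y0 y1] := andP y01.
rewrite subrr expr0n /= addr0.
suff H : (M / (n.+1%:R * d)) ^+ 2 * (n.+1%:R * y * (1 - y)) < 1.
  by rewrite [ltRHS](splitr e) ltrD2l -mulrA -[ltRHS]mulr1 ltr_pM2l ?divr_gt0.
have HN : M ^+ 2 / d ^+ 2 < n.+1%:R.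
  apply: (@le_lt_trans _ _ N%:R).
    rewrite /N natr_absz ger0_norm ?ceil_ge0 ?ceil_ge//.
    by apply: (lt_le_trans _ (divr_ge0 (sqr_ge0 _) (sqr_ge0 _))); rewrite ltrN10.
  by rewrite ltr_nat ltnS; near: n; exact: nbhs_infty_ge.
(* The variance [n y (1 - y)] grows like [n] only, against [n^2]. *)
have -> : (M / (n.+1%:R * d)) ^+ 2 * (n.+1%:R * y * (1 - y)) =
    (M ^+ 2 / d ^+ 2) / n.+1%:R * (y * (1 - y)).
  by field; rewrite (gt_eqF d0) /= addrC natr1 pnatr_eq0.
have r1 : (M ^+ 2 / d ^+ 2) / n.+1%:R < 1 by rewrite ltr_pdivrMr// mul1r.
have r0 : 0 <= (M ^+ 2 / d ^+ 2) / n.+1%:R.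
  by rewrite divr_ge0 ?divr_ge0 ?sqr_ge0// ltW.
by apply: (le_lt_trans _ r1); apply: ler_piMr => //; nra.
Unshelve. all: by end_near. Qed.

End Bernstein.

(** * Fractional powers of the Gram operator in rank one *)

Section Hilbert.
Context {R : realType} {V : lmodType R[i]} (ip : V -> V -> R[i]).

Record inner_product : Prop := InnerProduct {
  ip_linear : forall a u v w, ip (a *: u + v) w = a * ip u w + ip v w;
  ip_conj : forall u v, ip v u = Num.conj (ip u v);
  ip_pos : forall u, 0 <= complex.Re (ip u u);
  ip_def : forall u, complex.Re (ip u u) = 0 -> u = 0 }.

Hypothesis ipP : inner_product.

Local Notation nrm := (hnorm ip).

Lemma ipDl u v w : ip (u + v) w = ip u w + ip v w.
Proof. by rewrite -[u]scale1r (ip_linear ipP) mul1r scale1r. Qed.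

Lemma ip0l w : ip 0 w = 0.
Proof. by have /(congr1 (fun x => x - ip 0 w)) := ipDl 0 0 w; rewrite addr0 subrr addrK. Qed.

Lemma ipZl a u w : ip (a *: u) w = a * ip u w.
Proof. by rewrite -[a *: u]addr0 (ip_linear ipP) ip0l addr0. Qed.

Lemma ipBl u v w : ip (u - v) w = ip u w - ip v w.
Proof. by rewrite ipDl -scaleN1r ipZl mulN1r. Qed.

Lemma ipDr u v w : ip w (u + v) = ip w u + ip w v.
Proof. by rewrite (ip_conj ipP) ipDl rmorphD/= -!(ip_conj ipP). Qed.

Lemma ipZr a u w : ip w (a *: u) = Num.conj a * ip w u.
Proof. by rewrite (ip_conj ipP) ipZl rmorphM/= -(ip_conj ipP). Qed.

Lemma ipBr u v w : ip w (u - v) = ip w u - ip w v.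
Proof. by rewrite ipDr -scaleN1r ipZr rmorphN rmorph1 mulN1r. Qed.

Lemma ip_self u : ip u u = (complex.Re (ip u u))%:C.
Proof.
have := ip_conj ipP u u; case: (ip u u) => a b /= [] /eqP; rewrite -addr_eq0.
by rewrite -mulr2n mulrn_eq0/= => /eqP ->.
Qed.

Lemma hnorm_ge0 u : 0 <= nrm u. Proof. exact: sqrtr_ge0. Qed.

Lemma hnorm_sqr u : nrm u ^+ 2 = complex.Re (ip u u).
Proof. by rewrite /hnorm sqr_sqrtr// (ip_pos ipP). Qed.

Lemma ip_hnorm u : ip u u = (nrm u ^+ 2)%:C.
Proof. by rewrite hnorm_sqr -ip_self. Qed.

Lemma ip_ext u v : (forall w, ip u w = ip v w) -> u = v.
Proof.
move=> uv; apply/eqP; rewrite -subr_eq0; apply/eqP/(ip_def ipP).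
by rewrite ipBl uv subrr.
Qed.

Lemma cauchy_schwarz u v : cabs (ip u v) <= nrm u * nrm v.
Proof.
have [v0|v0] := eqVneq (nrm v) 0.
  have -> : v = 0 by apply: (ip_def ipP); rewrite -hnorm_sqr v0 expr0n.
  rewrite (ip_conj ipP) ip0l rmorph0.
  by rewrite /cabs Normc.normc0 mulr_ge0// hnorm_ge0.
rewrite -(@ler_pXn2r _ 2) ?nnegrE ?mulr_ge0 ?hnorm_ge0 ?cabs_ge0// exprMn.
have bp : 0 < nrm v ^+ 2 by rewrite exprn_gt0// lt_def v0 hnorm_ge0.
set b := nrm v ^+ 2 in bp *; set a := nrm u ^+ 2; set c := ip u v.
have := ip_pos ipP (b%:C *: u - c *: v).
rewrite !(ipBl, ipZl) !(ipBr, ipZr) !ip_hnorm -/a -/b (ip_conj ipP u v) -/c.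
have -> : b%:C * (Num.conj (b%:C) * a%:C - Num.conj c * c) - c * (Num.conj (b%:C) * Num.conj c - Num.conj c * b%:C) =
   (b * (a * b - cabs c ^+ 2))%:C.
  move: a b c {bp} => a b c; rewrite cabs_sqr; case: c => x y.
  by apply/eqP; rewrite eq_complex /=; apply/andP; split; apply/eqP; ring.
by rewrite /= pmulr_rge0// subr_ge0.
Qed.

Lemma hnormZ a u : nrm (a *: u) = cabs a * nrm u.
Proof.
apply/eqP; rewrite -(@eqrXn2 _ 2) ?mulr_ge0 ?hnorm_ge0 ?cabs_ge0//.
rewrite exprMn !hnorm_sqr (ipZl) ipZr mulrA mulCJ; apply/eqP.
by rewrite [in LHS]ip_self /= mul0r subr0.
Qed.

Lemma hnormD u v : nrm (u + v) <= nrm u + nrm v.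
Proof.
rewrite -(@ler_pXn2r _ 2) ?nnegrE ?addr_ge0 ?hnorm_ge0//.
rewrite hnorm_sqr ipDl !ipDr (ip_conj ipP u v).
have -> : complex.Re (ip u u + ip u v + (Num.conj (ip u v) + ip v v)) =
  nrm u ^+ 2 + nrm v ^+ 2 + 2 * complex.Re (ip u v).
  by rewrite !ip_hnorm; case: (ip u v) => x y /=; ring.
have := le_trans (Re_le_cabs (ip u v)) (cauchy_schwarz u v).
have := ler_norm (complex.Re (ip u v)).
by rewrite sqrrD => *; lra.
Qed.

Lemma hnormB u v : nrm (u - v) <= nrm u + nrm v.
Proof.
rewrite -scaleN1r; apply: (le_trans (hnormD _ _)).
by rewrite hnormZ /cabs /= oppr0 expr0n addr0 sqrrN expr1n sqrtr1 mul1r.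
Qed.

Definition op_bounded_by (T : V -> V) (M : R) := forall v, nrm (T v) <= M * nrm v.

Lemma opnorm_le T M : 0 <= M -> op_bounded_by T M -> opnorm ip T <= M.
Proof.
move=> M0 TM; apply: ge_inf; last by split.
by exists 0 => x [].
Qed.

Lemma opnorm_ge0 T M : op_bounded_by T M -> 0 <= opnorm ip T.
Proof.
move=> TM; apply: lb_le_inf; last by move=> x [].
exists (Num.max M 0); split; first by rewrite le_max lexx orbT.
move=> v; apply: (le_trans (TM v)); apply: ler_wpM2r; first exact: hnorm_ge0.
by rewrite le_max lexx.
Qed.

Lemma opnormP T M : op_bounded_by T M -> op_bounded_by T (opnorm ip T).
Proof.
move=> TM v; have [v0|v0] := eqVneq (nrm v) 0.
  by have := TM v; rewrite v0 !mulr0.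
have vp : 0 < nrm v by rewrite lt_def v0 hnorm_ge0.
rewrite -ler_pdivrMr//; apply: lb_le_inf.
  exists (Num.max M 0); split; first by rewrite le_max lexx orbT.
  move=> u; apply: (le_trans (TM u)); apply: ler_wpM2r; first exact: hnorm_ge0.
  by rewrite le_max lexx.
by move=> x [x0 xT]; rewrite ler_pdivrMr.
Qed.

(** The operator [T] is [u |-> <u, e> w] with [e] a unit vector, given through
its matrix coefficients because this is how a weakly defined operator comes. *)
Section RankOne.
Variables (T : V -> V) (e w : V).
Hypotheses (e1 : nrm e = 1) (TE : forall u v, ip (T u) v = ip u e * ip w v).

Local Notation c := (nrm w ^+ 2).

Lemma rank_one_apply u : T u = ip u e *: w.
Proof. by apply: ip_ext => v; rewrite TE ipZl. Qed.

(** [adjoint] selects some operator with the adjoint property, so one has to be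
exhibited; here it is [v |-> <v, w> e]. *)
Lemma rank_one_adjoint :
  bounded_op ip (adjoint ip T) /\ forall u v, ip (T u) v = ip u (adjoint ip T v).
Proof.
rewrite /adjoint; set P := [set S | _]; apply: (@xgetPex _ _ P).
exists (fun v => ip v w *: e); split; first split.
- by move=> a u v; rewrite (ip_linear ipP) scalerDl scalerA.
- exists (nrm w) => v; rewrite hnormZ e1 mulr1 mulrC; exact: cauchy_schwarz.
- by move=> u v; rewrite TE ipZr (ip_conj ipP v w) mulrC.
Qed.

Local Notation A := (adjoint ip T \o T).

Lemma rank_one_gram u : A u = (c%:C * ip u e) *: e.
Proof.
have [_ Tadj] := rank_one_adjoint.
apply: ip_ext => v; rewrite (ip_conj ipP) -Tadj !rank_one_apply !ipZl ipZr ip_hnorm.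
by rewrite 2!conjM conj_real conjCK (ip_conj ipP v e); ring.
Qed.

Lemma gram_bounded : op_bounded_by A c.
Proof.
move=> v; rewrite rank_one_gram hnormZ e1 mulr1 /cabs Normc.normcM -!/(cabs _).
rewrite {1}/cabs /= expr0n addr0 sqrtr_sqr ger0_norm ?sqr_ge0//.
apply: ler_wpM2l; first exact: sqr_ge0.
by have := cauchy_schwarz v e; rewrite e1 mulr1.
Qed.

Lemma gram_opnorm_ge : c <= opnorm ip A.
Proof.
have := opnormP gram_bounded e; rewrite e1 mulr1; apply: le_trans.
rewrite rank_one_gram ip_hnorm e1 expr1n mulr1 hnormZ e1 mulr1.
by rewrite /cabs /= expr0n addr0 sqrtr_sqr ger0_norm ?sqr_ge0.
Qed.

Lemma gram_iter k v :
  iter k A v = (0 ^+ k : R)%:C *: (v - ip v e *: e) + ((c ^+ k)%:C * ip v e) *: e.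
Proof.
elim: k => [|k IH]; first by rewrite /= !expr0 scale1r mul1r subrK.
rewrite iterS IH rank_one_gram ipDl !ipZl ipBl !ipZl ip_hnorm e1 expr1n !mulr1.
rewrite subrr mulr0 add0r expr0n /= scale0r add0r mulrA.
by rewrite -rmorphM -exprS.
Qed.

(** [A] is [c] on [e] and 0 on the orthogonal complement of [e], so a
polynomial in [A] acts there by its values at [c] and at 0. *)
Lemma gram_horner p v : op_horner p A v =
  (p.[0])%:C *: (v - ip v e *: e) + ((p.[c])%:C * ip v e) *: e.
Proof.
rewrite /op_horner; transitivity (\sum_(k < size p)
  ((p`_k * 0 ^+ k)%:C *: (v - ip v e *: e) + ((p`_k * c ^+ k)%:C * ip v e) *: e)).
  by apply: eq_bigr => k _; rewrite gram_iter scalerDr !scalerA mulrA !realCM.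
rewrite big_split/= -!scaler_suml !horner_coef.
by congr (_ *: _ + _ *: _); rewrite realC_sum.
Qed.

Lemma combination_bounded (x y : R) :
  op_bounded_by (fun v => x%:C *: (v - ip v e *: e) + (y%:C * ip v e) *: e)
    (2 * `|x| + `|y|).
Proof.
move=> v; apply: (le_trans (hnormD _ _)); rewrite !hnormZ cabsM !cabs_real e1 mulr1.
have h := cauchy_schwarz v e; rewrite e1 mulr1 in h.
have h2 := hnormB v (ip v e *: e); rewrite hnormZ e1 mulr1 in h2.
rewrite mulrDl; apply: lerD; last by apply: ler_wpM2l.
rewrite [2 * _]mulrC -mulrA; apply: ler_wpM2l => //; apply: (le_trans h2); lra.
Qed.

Variable s : R.
Hypothesis s01 : 0 < s <= 1.

(** The power is a chosen limit, so its defining properties are available only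
once some limit is known to exist.  The witness is [c^s] on [e] and 0 on the
complement of [e]; the approximation error is at most
[2 |p(0)| + |p(c) - c^s|]. *)
Lemma rank_one_powR_ex :
  bounded_op ip (op_powR ip A s) /\
       exists p : nat -> {poly R},
         (forall d : R, 0 < d -> \forall n \near \oo,
            forall x : R, 0 <= x <= opnorm ip A -> `|(p n).[x] - x `^ s| < d) /\
         (fun n => opnorm ip (fun v => op_horner (p n) A v - op_powR ip A s v)) @ \oo --> 0.
Proof.
rewrite /op_powR; set P := [set B | _]; apply: (@xgetPex _ _ P).
(* The [+ 1] keeps the interval of approximation nondegenerate if [A] is 0. *)
pose M := opnorm ip A + 1.
have A0 := opnorm_ge0 gram_bounded.
have M0 : 0 < M by rewrite /M ltr_wpDl.
have [p pP] := powR_poly_approx s01 M0.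
have s0 : s != 0 by case/andP: s01 => s0 _; rewrite gt_eqF.
exists (fun v => ((c `^ s)%:C * ip v e) *: e); split; first split.
- by move=> a u v; rewrite (ip_linear ipP) scalerA -scalerDl mulrDr; congr (_ *: _); ring.
- exists (2 * `|0 : R| + `|c `^ s|) => v.
  by have := combination_bounded 0 (c `^ s) v; rewrite scale0r add0r.
exists p; split.
  move=> d d0; apply: filterS (pP d d0) => n H x /andP[x0 xM]; apply: H.
  by rewrite x0 (le_trans xM)// lerDl.
apply/cvgrPdist_lt => d d0; rewrite -(@pmulr_rgt0 _ 4^-1)// in d0.
apply: filterS (pP _ d0) => n H.
have H0 := H 0; have Hc := H c; rewrite powR0// subr0 in H0.
rewrite sub0r normrN.
have fE : (fun v => op_horner (p n) A v - ((c `^ s)%:C * ip v e) *: e) =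
   (fun v => (p n).[0]%:C *: (v - ip v e *: e) + (((p n).[c] - c `^ s)%:C * ip v e) *: e).
  apply/funext => v; rewrite gram_horner -addrA -scalerBl -mulrBl; congr (_ + (_ * _) *: _).
  by rewrite -rmorphB.
rewrite fE; have Db := combination_bounded (p n).[0] ((p n).[c] - c `^ s).
rewrite ger0_norm; last exact: opnorm_ge0 Db.
apply: (le_lt_trans (opnorm_le _ Db)).
  by rewrite addr_ge0// mulr_ge0.
have {}H0 := H0 _; have {}Hc := Hc _.
have h0 : `|(p n).[0]| < 4^-1 * d by apply: H0; rewrite lexx ltW.
have hc : `|(p n).[c] - c `^ s| < 4^-1 * d.
  by apply: Hc; rewrite sqr_ge0 /= (le_trans gram_opnorm_ge)// lerDl.
lra.
Qed.

(** Any two limits have the same diagonal entry at [e]: [<p_n(A) e, e>] is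
[p_n(c)], which tends both to the entry of the limit and to [c^s]. *)
Lemma rank_one_powR_diag : complex.Re (ip (op_powR ip A s e) e) = c `^ s.
Proof.
have [[Blin [K BK]] [p [pP pB]]] := rank_one_powR_ex.
set B := op_powR _ _ _ in Blin BK pB *.
apply/eqP; rewrite -subr_eq0 -normr_eq0; apply/negPn/negP => neq.
have d0 : 0 < `|complex.Re (ip (B e) e) - c `^ s| by rewrite lt_def neq normr_ge0.
set d := `|_| in d0; rewrite -(@pmulr_rgt0 _ 2^-1)// in d0.
move/cvgrPdist_lt/(_ _ d0) : pB => pB.
have [n [H1 H2]] := @filter_ex _ _ eventually_filter _ (filterI (pP _ d0) pB).
move: H2; rewrite sub0r normrN; set D := fun v : V => _ => H2.
have Dbound : op_bounded_by D (2 * `|(p n).[0]| + `|(p n).[c]| + K).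
  move=> v; rewrite /D gram_horner; apply: (le_trans (hnormB _ _)).
  by rewrite mulrDl; apply: lerD => //; exact: combination_bounded.
have De := opnormP Dbound e; rewrite e1 mulr1 in De.
have h2 : cabs (ip (D e) e) < 2^-1 * d.
  apply: (le_lt_trans (cauchy_schwarz _ _)); rewrite e1 mulr1.
  by apply: (le_lt_trans De); apply: le_lt_trans H2; exact: ler_norm.
have h1 : `|(p n).[c] - c `^ s| < 2^-1 * d by apply: H1; rewrite sqr_ge0 gram_opnorm_ge.
have h3 : `|(p n).[c] - complex.Re (ip (B e) e)| < 2^-1 * d.
  apply: le_lt_trans h2; apply: le_trans (Re_le_cabs _).
  rewrite /D gram_horner ip_hnorm e1 expr1n mulr1 scale1r subrr scaler0 add0r.
  by rewrite ipBl ipZl ip_hnorm e1 expr1n mulr1; case: (ip (B e) e).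
have := ler_distD (p n).[c] (complex.Re (ip (B e) e)) (c `^ s).
by rewrite -/d [X in _ <= X + _]distrC; lra.
Qed.

End RankOne.

(** The trace is a supremum of finite partial sums, hence at least the single
term at the basis vector [b i], whose span contains the range of the Gram
operator.  The restriction [q <= 2] is what makes [x^(q/2)] Hoelder. *)
Lemma schatten_rank_one_ge (I : choiceType) (b : I -> V) (i : I) (T : V -> V) (w : V) (q : R) :
  0 < q <= 2 -> nrm (b i) = 1 ->
  (forall u v, ip (T u) v = ip u (b i) * ip w v) ->
  ((nrm w `^ q)%:E <= schatten_norm_pow ip b q T)%E.
Proof.
move=> /andP[q0 q2] bi1 TE; rewrite /schatten_norm_pow /op_trace.
have s01 : 0 < q / 2 <= 1 by rewrite divr_gt0//= ler_pdivrMr// mul1r.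
apply: ereal_sup_ubound; exists [set i]; first by split.
rewrite fsbig_set1 (rank_one_powR_diag bi1 TE s01); congr (_%:E).
by rewrite -(powR_mulrn _ (hnorm_ge0 _)) -powRrM mulrCA divff ?mulr1.
Qed.

End Hilbert.

(** * Lebesgue integrals of periodic functions *)

Section Translation.
Context {R : realType}.
Local Notation mu := (@lebesgue_measure R).

Let shiftc (c : R) : measurableTypeR R -> measurableTypeR R := fun x => x + c.

Let measurable_shiftc c : measurable_fun setT (shiftc c).
Proof. by apply: measurable_funD => //; exact: measurable_cst. Qed.

(** Lebesgue measure is determined by its values on half-open intervals. *)
Lemma lebesgue_measure_shift (c : R) (A : set R) : measurable A ->
  pushforward mu (shiftc c) A = mu A.
Proof.
move=> mA; apply/esym/(@lebesgue_measure_unique _ (pushforward mu (shiftc c))) => //=.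
move=> _ [[a b]] _ <-.
have -> : pushforward mu (shiftc c) `]a, b] = mu `](a - c), (b - c)].
  rewrite /pushforward; congr (mu _); apply/seteqP; split=> x /=;
  by rewrite /shiftc !in_itv/= ltrBlDr lerBrDr.
rewrite !lebesgue_measure_itv/= !lte_fin ltrD2r.
by case: ifP => // _; rewrite -!EFinB; congr (_%:E); ring.
Qed.

Lemma ge0_integral_shift (D : set R) (v : R -> \bar R) (c : R) :
  measurable D -> measurable_fun D v -> (forall x, D x -> 0 <= v x)%E ->
  (\int[mu]_(x in D) v x = \int[mu]_(x in [set x : R | D (x + c)%R]) v (x + c)%R)%E.
Proof.
move=> mD mv v0.
rewrite -[RHS](@ge0_integral_pushforward _ _ _ _ _ (shiftc c) (measurable_shiftc c) mu D v)//.
  by apply: eq_measure_integral => A mA _; exact/esym/lebesgue_measure_shift.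
by move=> y /set_mem; exact: v0.
Qed.

Lemma ge0_integral_opp (D : set R) (v : R -> \bar R) :
  measurable D -> measurable_fun D v -> (forall x, D x -> 0 <= v x)%E ->
  (\int[mu]_(x in D) v x = \int[mu]_(x in [set x : R | D (- x)%R]) v (- x)%R)%E.
Proof.
move=> mD mv v0.
have mN : measurable_fun setT (-%R : measurableTypeR R -> measurableTypeR R).
  exact: oppr_measurable.
rewrite -[RHS](@ge0_integral_pushforward _ _ _ _ _ _ mN mu D v)//.
  by apply: eq_measure_integral => A mA _; exact/esym/lebesgue_measureN.
by move=> y /set_mem; exact: v0.
Qed.

End Translation.

Section Periodic.
Context {R : realType}.
Local Notation mu := (@lebesgue_measure R).
Local Notation arc := (circle_arc R).

Definition arc_at (k : int) : set R := `[(2 * pi *~ k - pi), (2 * pi *~ k + pi)[.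

Lemma two_pi_gt0 : 0 < 2 * pi :> R. Proof. by rewrite mulr_gt0// pi_gt0. Qed.

Lemma periodic_int {U : Type} (v : R -> U) : (forall s, v (s + 2 * pi) = v s) ->
  forall (k : int) s, v (s + 2 * pi *~ k) = v s.
Proof.
move=> vp; have vn (n : nat) s : v (s + 2 * pi *+ n) = v s.
  by elim: n s => [|n IH] s; rewrite ?mulr0n ?addr0// mulrSr addrA vp.
move=> [n|n] s; first exact: vn.
by rewrite NegzE mulrNz -[LHS](vn n.+1) subrK.
Qed.

Lemma cover_arc_at (s : R) : exists k : int, arc_at k s.
Proof.
pose x := (s + pi) / (2 * pi); exists (Num.floor x).
have h0 := two_pi_gt0; have xE : x * (2 * pi) = s + pi by rewrite /x divfK// gt_eqF.
rewrite /arc_at/= in_itv/= -mulrzl.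
have := floor_le_tmp x; have := floorD1_gt x; rewrite intrD1.
rewrite -(ltr_pM2r h0) -[_ <= x](ler_pM2r h0) xE mulrDl mul1r => *; apply/andP; split; lra.
Qed.

(** Functions on the circle are only known to be measurable over one period;
convolution evaluates them at differences, which leave that period. *)
Lemma periodic_measurable d (T : measurableType d) (v : R -> T) :
  (forall s, v (s + 2 * pi) = v s) -> measurable_fun arc v -> measurable_fun setT v.
Proof.
move=> vp mv.
(* The translates of the arc are indexed by integers; measurability is glued
   along a sequence, hence the enumeration of [int]. *)
pose E n := if @unpickle int n is Some k then arc_at k else set0.
have mE n : measurable (E n).
  by rewrite /E; case: unpickle => [k|] //; exact: measurable_itv.
have -> : setT = \bigcup_n E n.
  apply/seteqP; split=> // s _; have [k ks] := cover_arc_at s.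
  by exists (pickle k) => //; rewrite /E pickleK.
apply/(measurable_fun_bigcup _ mE) => n; rewrite /E; case: unpickle => [k|]; last exact: measurable_fun_set0.
have -> : v = v \o (fun s => s + 2 * pi *~ (- k)).
  by apply/funext => s /=; rewrite periodic_int.
apply: (measurable_comp (F := arc)) => //; first exact: measurable_itv.
  move=> _ [s] + <-; rewrite /arc_at /circle_arc/= !in_itv/= mulrNz.
  by move=> /andP[? ?]; apply/andP; split; lra.
by apply: measurable_funD => //; exact: measurable_cst.
Qed.

Let period_shift (v : R -> \bar R) (c d : R) : measurable_fun setT v ->
  (forall x, 0 <= v x)%E -> (forall s, v (s + 2 * pi) = v s)%R ->
  (\int[mu]_(s in `[(c + 2 * pi)%R, (d + 2 * pi)%R[) v s = \int[mu]_(s in `[c, d[) v s)%E.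
Proof.
move=> mv v0 vp; rewrite (@ge0_integral_shift _ _ _ (2 * pi))//; last exact: measurable_funTS.
under eq_integral do rewrite vp.
congr (integral _ _ _); apply/seteqP; split => x /=; rewrite !in_itv/= => /andP[? ?];
  apply/andP; split; lra.
Qed.

(** The part of the moved window that leaves the arc is carried back onto the
uncovered part by one period. *)
Lemma periodic_integral_window (v : R -> \bar R) (c : R) : measurable_fun setT v ->
  (forall x, 0 <= v x)%E -> (forall s, v (s + 2 * pi) = v s)%R -> - pi <= c <= pi ->
  (\int[mu]_(s in `[(c - pi)%R, (c + pi)%R[) v s = \int[mu]_(s in arc) v s)%E.
Proof.
move=> mv v0 vp /andP[c1 c2].
have split3 (a b d : R) : a <= b -> b <= d ->
    (\int[mu]_(s in `[a, d[) v s = \int[mu]_(s in `[a, b[) v s + \int[mu]_(s in `[b, d[) v s)%E.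
  move=> ab bd; rewrite -integral_setU//; last 2 first.
  - exact: measurable_funTS.
  - rewrite disj_set2E; apply/eqP/seteqP; split => x //=; rewrite !in_itv/=.
    by move=> [/andP[_ h1] /andP[h2 _]]; lra.
  congr (integral _ _ _); apply/seteqP; split => x /=; rewrite !in_itv/=.
    move=> /andP[ax xd]; have [h|h] := leP b x; [right|left]; lra.
  by move=> [/andP[? ?]|/andP[? ?]]; lra.
have E1 : - pi + 2 * pi = pi :> R by ring.
have E2 : c - pi + 2 * pi = c + pi by ring.
have [c0|c0] := leP 0 c.
  rewrite (split3 _ pi); [|lra|lra].
  rewrite /circle_arc (split3 (- pi) (c - pi) pi); [|lra|lra].
  by rewrite addeC; congr (_ + _)%E; rewrite -[RHS]period_shift// E1 E2.
rewrite (split3 _ (- pi)); [|lra|lra].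
rewrite /circle_arc (split3 (- pi) (c + pi) pi); [|lra|lra].
by rewrite addeC; congr (_ + _)%E; rewrite -[LHS]period_shift// E1 E2.
Qed.

Lemma periodic_integral_shift (v : R -> \bar R) (c : R) : measurable_fun setT v ->
  (forall x, 0 <= v x)%E -> (forall s, v (s + 2 * pi) = v s)%R -> - pi <= c <= pi ->
  (\int[mu]_(s in arc) v (s + c)%R = \int[mu]_(s in arc) v s)%E.
Proof.
move=> mv v0 vp c12; rewrite -(periodic_integral_window mv v0 vp c12).
rewrite /circle_arc [RHS](@ge0_integral_shift _ _ _ c)//; last exact: measurable_funTS.
congr (integral _ _ _); apply/seteqP; split => x /=; rewrite !in_itv/= => /andP[? ?];
  apply/andP; split; lra.
Qed.

(** Reflecting exchanges the open and closed ends of the arc, which the integral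
does not see. *)
Let periodic_integral_reflect_window (v : R -> \bar R) (t : R) : measurable_fun setT v ->
  (forall x, 0 <= v x)%E -> (forall s, v (s + 2 * pi) = v s)%R -> - pi <= t <= pi ->
  (\int[mu]_(s in arc) v (t - s)%R = \int[mu]_(s in arc) v s)%E.
Proof.
move=> mv v0 vp t12; rewrite -(periodic_integral_shift mv v0 vp t12).
have mvt : measurable_fun setT (fun s : R => v (s + t)).
  by apply: (measurableT_comp mv); apply: measurable_funD => //; exact: measurable_cst.
rewrite /circle_arc integral_itv_bndo_bndc; last first.
  apply: measurable_funTS; apply: (measurableT_comp mv).
  by apply: measurable_funB => //; exact: measurable_cst.
rewrite [RHS]integral_itv_bndo_bndc; last exact: measurable_funTS.
rewrite [RHS]ge0_integral_opp//; last exact: measurable_funTS.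
under [RHS]eq_integral do rewrite addrC.
congr (integral _ _ _); apply/seteqP; split => x /=; rewrite !in_itv/= => /andP[? ?];
  apply/andP; split; lra.
Qed.

Lemma periodic_integral_reflect (v : R -> \bar R) (t : R) : measurable_fun setT v ->
  (forall x, 0 <= v x)%E -> (forall s, v (s + 2 * pi) = v s)%R ->
  (\int[mu]_(s in arc) v (t - s)%R = \int[mu]_(s in arc) v s)%E.
Proof.
move=> mv v0 vp; have [k] := cover_arc_at t; rewrite /arc_at/= in_itv/= => /andP[k1 k2].
rewrite -(periodic_integral_reflect_window mv v0 vp (t := t - 2 * pi *~ k)); last first.
  by apply/andP; split; lra.
apply: eq_integral => s _; rewrite -(periodic_int vp k (t - 2 * pi *~ k - s)).
by rewrite addrAC subrK.
Qed.

Lemma periodic_Rintegral_reflect (v : R -> R) (t : R) : measurable_fun setT v ->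
  (forall s, v (s + 2 * pi) = v s) ->
  \int[mu]_(s in arc) v (t - s) = \int[mu]_(s in arc) v s.
Proof.
move=> mv vp; have mE : measurable_fun setT (EFin \o v) by exact/measurable_EFinP.
rewrite /Rintegral; congr (fine _); rewrite integralE [RHS]integralE.
rewrite -(periodic_integral_reflect t (measurable_funepos mE))//; last first.
  by move=> s; rewrite !funeposE /= vp.
rewrite -(periodic_integral_reflect t (measurable_funeneg mE))//; last first.
  by move=> s; rewrite !funenegE /= vp.
by congr (_ - _)%E; apply: eq_integral => s _; rewrite !(funeposE, funenegE).
Qed.

Lemma arc_measure : mu arc = (2 * pi)%:E.
Proof.
rewrite /circle_arc lebesgue_measure_itv/= lte_fin ifT -?EFinB; last first.
  by have := pi_gt0 R; lra.
by congr (_%:E); ring.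
Qed.

End Periodic.

(** * Fubini for real and complex valued functions *)

Lemma restrict_indic (R : realType) (T : Type) (D : set T) (v : T -> R) :
  v \_ D = (fun x => \1_D x * v x).
Proof.
by apply/funext => x; rewrite patchE indicE; case: ifP; rewrite ?mul1r ?mul0r.
Qed.

Section RFubini.
Context d1 d2 (T1 : measurableType d1) (T2 : measurableType d2) (R : realType).
Variables (m1 : {sigma_finite_measure set T1 -> \bar R})
          (m2 : {sigma_finite_measure set T2 -> \bar R}) (f : T1 * T2 -> R).
Hypothesis fi : (m1 \x m2)%E.-integrable setT (EFin \o f).

Let mfine d (T : measurableType d) (g : T -> \bar R) :
  measurable_fun setT g -> measurable_fun setT (fun x => (fine (g x))%:E).
Proof. by move=> mg; apply/measurable_EFinP/(measurableT_comp (fine_measurable measurableT) mg). Qed.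

(** The inner integral is finite only almost everywhere; where it is infinite the
real-valued integral is 0 by convention, on a null set. *)
Lemma Rintegral_fubini1 :
  \int[m1]_x \int[m2]_y f (x, y) = \int[(m1 \x m2)%E]_z f z.
Proof.
rewrite [RHS]/Rintegral -[in RHS](integral12_prod_meas1 fi).
have mF := measurable_fubini_F fi.
rewrite /Rintegral; congr fine; apply: ae_eq_integral => //; first exact: mfine.
have := ae_integrable1 fi; apply: filterS => x /= xi _.
by rewrite fineK//; exact: integrable_fin_num xi.
Qed.

Lemma integrable_Rfubini1 : m1.-integrable setT (EFin \o (fun x => \int[m2]_y f (x, y))).
Proof.
apply: le_integrable (integrable_fubini_F fi) => //.
  exact: mfine (measurable_fubini_F fi).
move=> x _ /=; rewrite /fubini_F /Rintegral.
by case: (integral _ _ _) => [r| |] //=; rewrite ?leey// normr0 leey.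
Qed.

Lemma Rintegral_fubini2 :
  \int[m2]_y \int[m1]_x f (x, y) = \int[(m1 \x m2)%E]_z f z.
Proof.
rewrite [RHS]/Rintegral -[in RHS](integral21_prod_meas1 fi).
have mG := measurable_fubini_G fi.
rewrite /Rintegral; congr fine; apply: ae_eq_integral => //; first exact: mfine.
have := ae_integrable2 fi; apply: filterS => x /= xi _.
by rewrite fineK//; exact: integrable_fin_num xi.
Qed.

End RFubini.

Section ComplexIntegral.
Context d (T : measurableType d) (R : realType).
Variables (mu : {measure set T -> \bar R}) (D : set T).
Hypothesis mD : measurable D.
Implicit Types f g : T -> R[i].

Definition cmeasurable_fun f :=
  measurable_fun D (fun x => complex.Re (f x)) /\ measurable_fun D (fun x => complex.Im (f x)).

Definition cintegrable f :=
  mu.-integrable D (EFin \o (fun x => complex.Re (f x))) /\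
  mu.-integrable D (EFin \o (fun x => complex.Im (f x))).

Lemma cmeasurableM f g : cmeasurable_fun f -> cmeasurable_fun g ->
  cmeasurable_fun (fun x => f x * g x).
Proof.
move=> [fr fi] [gr gi]; split.
  by under eq_fun do rewrite ReM; apply: measurable_funB; exact: measurable_funM.
by under eq_fun do rewrite ImM; apply: measurable_funD; exact: measurable_funM.
Qed.

Lemma cmeasurableJ f : cmeasurable_fun f -> cmeasurable_fun (fun x => Num.conj (f x)).
Proof.
move=> [fr fi]; split; first by under eq_fun do rewrite ReJ.
by under eq_fun do rewrite ImJ; exact: measurable_funN.
Qed.

Lemma cmeasurable_real (u : T -> R) : measurable_fun D u ->
  cmeasurable_fun (fun x => (u x)%:C).
Proof. by move=> mu'; split => //=; exact: measurable_cst. Qed.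

Lemma cintegrable_real (u : T -> R) : mu.-integrable D (EFin \o u) ->
  cintegrable (fun x => (u x)%:C).
Proof. by move=> iu; split => //=; exact: integrable0. Qed.

Lemma measurable_cabs f : cmeasurable_fun f -> measurable_fun D (fun x => cabs (f x)).
Proof.
move=> [fr fi]; under eq_fun do rewrite cabsE.
apply: (measurableT_comp (continuous_measurable_fun (@sqrt_continuous R))).
by apply: measurable_funD; exact: measurable_funX.
Qed.

Lemma cintegrable_measurable f : cintegrable f -> cmeasurable_fun f.
Proof. by move=> [/measurable_int/measurable_EFinP ? /measurable_int/measurable_EFinP ?]. Qed.

Lemma cintegrable_le f (g : T -> R) : cmeasurable_fun f ->
  mu.-integrable D (EFin \o g) -> (forall x, D x -> cabs (f x) <= g x) -> cintegrable f.
Proof.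
move=> [fr fi] gi fg; split.
  apply: le_integrable gi => //; first exact/measurable_EFinP.
  move=> x Dx /=; rewrite lee_fin; apply: (le_trans (Re_le_cabs _)).
  by apply: (le_trans (fg _ Dx)); exact: ler_norm.
apply: le_integrable gi => //; first exact/measurable_EFinP.
move=> x Dx /=; rewrite lee_fin; apply: (le_trans (Im_le_cabs _)).
by apply: (le_trans (fg _ Dx)); exact: ler_norm.
Qed.

Lemma cintegrable_cabs f : cintegrable f -> mu.-integrable D (EFin \o (fun x => cabs (f x))).
Proof.
move=> fi; have mf := cintegrable_measurable fi; case: fi => fr fi.
have := integrableD mD (integrable_abse fr) (integrable_abse fi).
apply: le_integrable => //; first exact/measurable_EFinP/measurable_cabs.
move=> x Dx /=; rewrite lee_fin ger0_norm ?cabs_ge0//.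
by rewrite ger0_norm ?addr_ge0//; exact: cabs_le_ReIm.
Qed.

Lemma cintegrableZ a f : cintegrable f -> cintegrable (fun x => a * f x).
Proof.
move=> fi; have mf := cintegrable_measurable fi.
apply: (@cintegrable_le _ (fun x => cabs a * cabs (f x))).
- apply: cmeasurableM => //; split; exact: measurable_cst.
- by have := integrableZl mD (cabs a) (cintegrable_cabs fi).
- by move=> x _; rewrite cabsM.
Qed.

Lemma cintegrableD f g : cintegrable f -> cintegrable g -> cintegrable (fun x => f x + g x).
Proof.
move=> [fr fi] [gr gi]; split.
  by have := integrableD mD fr gr; apply: eq_integrable => // x _ /=; rewrite ReD.
by have := integrableD mD fi gi; apply: eq_integrable => // x _ /=; rewrite ImD.
Qed.

Lemma eq_cintegral f g : (forall x, D x -> f x = g x) -> cintegral mu D f = cintegral mu D g.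
Proof.
by move=> fg; rewrite /cintegral; congr Complex; apply: eq_Rintegral => x /set_mem Dx; rewrite fg.
Qed.

Lemma ae_eq_cintegral f g : cmeasurable_fun f -> cmeasurable_fun g ->
  {ae mu, forall x, D x -> f x = g x} -> cintegral mu D f = cintegral mu D g.
Proof.
move=> [fr fi] [gr gi] fg; rewrite /cintegral /Rintegral; congr (Complex (fine _) (fine _)).
  apply: ae_eq_integral => //; [exact/measurable_EFinP..|].
  by apply: filterS fg => x H Dx; rewrite H.
apply: ae_eq_integral => //; [exact/measurable_EFinP..|].
by apply: filterS fg => x H Dx; rewrite H.
Qed.

Lemma cintegralD f g : cintegrable f -> cintegrable g ->
  cintegral mu D (fun x => f x + g x) = cintegral mu D f + cintegral mu D g.
Proof.
move=> [fr fi] [gr gi]; rewrite /cintegral.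
under eq_Rintegral do rewrite ReD.
under [X in Complex _ X]eq_Rintegral do rewrite ImD.
by rewrite !RintegralD.
Qed.

Lemma cintegralZ a f : cintegrable f ->
  cintegral mu D (fun x => a * f x) = a * cintegral mu D f.
Proof.
move=> [fr fi]; rewrite /cintegral.
under eq_Rintegral do rewrite ReM.
under [X in Complex _ X]eq_Rintegral do rewrite ImM.
have Z (k : R) (u : T -> R) : mu.-integrable D (EFin \o u) ->
   mu.-integrable D (EFin \o (fun x => k * u x)).
  by move=> ui; have := integrableZl mD k ui.
rewrite RintegralB ?RintegralD//; [|exact: Z..].
by rewrite !RintegralZl//; case: a.
Qed.

Lemma cintegralJ f : cintegrable f ->
  cintegral mu D (fun x => Num.conj (f x)) = Num.conj (cintegral mu D f).
Proof.
move=> [fr fi]; rewrite /cintegral; under eq_Rintegral do rewrite ReJ.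
under [X in Complex _ X]eq_Rintegral do rewrite ImJ -mulN1r.
by rewrite RintegralZl// mulN1r.
Qed.

Lemma cintegral_mkcond f :
  cintegral mu D f = cintegral mu setT (fun x => (\1_D x)%:C * f x).
Proof.
rewrite /cintegral; under [in RHS]eq_Rintegral do rewrite Re_realM.
under [X in _ = Complex _ X]eq_Rintegral do rewrite Im_realM.
by rewrite 2!(Rintegral_mkcond mu D) !restrict_indic.
Qed.

End ComplexIntegral.

Arguments cmeasurable_fun {d T R} D f.

Section Restriction.
Context d (T : measurableType d) (R : realType).
Variables (mu : {measure set T -> \bar R}) (D : set T).
Hypothesis mD : measurable D.
Implicit Types f g : T -> R[i].

Lemma cintegrable_mkcond f : cintegrable mu D f ->
  cintegrable mu setT (fun x => (\1_D x)%:C * f x).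
Proof.
move=> [/(integrable_mkcond (mu := mu) _ mD) fr /(integrable_mkcond (mu := mu) _ mD) fi]; split.
  apply: eq_integrable fr => // x _ /=.
  by rewrite Re_realM patchE indicE; case: ifP; rewrite ?mul1r ?mul0r.
apply: eq_integrable fi => // x _ /=.
by rewrite Im_realM patchE indicE; case: ifP; rewrite ?mul1r ?mul0r.
Qed.

Lemma cmeasurable_comp d' (S : measurableType d') (phi : S -> T) f :
  cmeasurable_fun setT f -> measurable_fun setT phi -> cmeasurable_fun setT (f \o phi).
Proof. by move=> [fr fi] mphi; split; [exact: (measurableT_comp fr)|exact: (measurableT_comp fi)]. Qed.

End Restriction.

Section ComplexFubini.
Context d1 d2 (T1 : measurableType d1) (T2 : measurableType d2) (R : realType).
Variables (m1 : {sigma_finite_measure set T1 -> \bar R})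
          (m2 : {sigma_finite_measure set T2 -> \bar R}).

Lemma cfubini1 (f : T1 * T2 -> R[i]) : cintegrable (m1 \x m2)%E setT f ->
  cintegral m1 setT (fun x => cintegral m2 setT (fun y => f (x, y))) =
  cintegral (m1 \x m2)%E setT f.
Proof.
by move=> [fr fi]; rewrite /cintegral /= (Rintegral_fubini1 fr) (Rintegral_fubini1 fi).
Qed.

Lemma cfubini2 (f : T1 * T2 -> R[i]) : cintegrable (m1 \x m2)%E setT f ->
  cintegral m2 setT (fun y => cintegral m1 setT (fun x => f (x, y))) =
  cintegral (m1 \x m2)%E setT f.
Proof.
by move=> [fr fi]; rewrite /cintegral /= (Rintegral_fubini2 fr) (Rintegral_fubini2 fi).
Qed.

Lemma cintegrable_tensor (u : T1 -> R[i]) (v : T2 -> R[i]) :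
  cintegrable m1 setT u -> cintegrable m2 setT v ->
  cintegrable (m1 \x m2)%E setT (fun z => u z.1 * v z.2).
Proof.
move=> ui vi; have mu := cintegrable_measurable ui; have mv := cintegrable_measurable vi.
have muv : cmeasurable_fun setT (fun z : T1 * T2 => u z.1 * v z.2).
  apply: cmeasurableM.
    exact: (cmeasurable_comp mu (@measurable_fst _ _ T1 T2)).
  exact: (cmeasurable_comp mv (@measurable_snd _ _ T1 T2)).
apply: (cintegrable_le measurableT muv (g := fun z => cabs (u z.1 * v z.2))) => //.
apply/integrable12ltyP; first exact/measurable_EFinP/measurable_cabs.
have cu := cintegrable_cabs measurableT ui; have cv := cintegrable_cabs measurableT vi.
pose K := \int[m2]_y cabs (v y).
have E x : (\int[m2]_y `|(cabs (u x * v y))%:E| = K%:E * (cabs (u x))%:E)%E.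
  under eq_integral do rewrite /= ger0_norm ?cabs_ge0// cabsM EFinM.
  by rewrite integralZl// muleC /K /Rintegral fineK//; exact: integrable_fin_num cv.
rewrite (eq_integral _ _ (fun x _ => E x)) integralZl//.
by rewrite -[X in (_ * X)%E]fineK ?ltry//; exact: integrable_fin_num cu.
Qed.

Lemma cintegral_tensor (u : T1 -> R[i]) (v : T2 -> R[i]) :
  cintegrable m1 setT u -> cintegrable m2 setT v ->
  cintegral (m1 \x m2)%E setT (fun z => u z.1 * v z.2) =
  cintegral m1 setT u * cintegral m2 setT v.
Proof.
move=> ui vi; rewrite -(cfubini1 (cintegrable_tensor ui vi)).
transitivity (cintegral m1 setT (fun x => cintegral m2 setT v * u x)).
  by apply: eq_cintegral => x _ /=; rewrite cintegralZ// mulrC.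
by rewrite cintegralZ// mulrC.
Qed.

Lemma cmeasurable_fubini2 (f : T1 * T2 -> R[i]) : cintegrable (m1 \x m2)%E setT f ->
  cmeasurable_fun setT (fun y => cintegral m1 setT (fun x => f (x, y))).
Proof.
move=> [fr fi]; split.
  exact: (measurableT_comp (fine_measurable measurableT) (measurable_fubini_G fr)).
exact: (measurableT_comp (fine_measurable measurableT) (measurable_fubini_G fi)).
Qed.

(** Tonelli's criterion, with the inner integral of the modulus given in
closed form. *)
Lemma cintegrable_tonelli2 (f : T1 * T2 -> R[i]) (K : T2 -> R) :
  cmeasurable_fun setT f ->
  (forall y, m1.-integrable setT (EFin \o (fun x => cabs (f (x, y))))) ->
  (forall y, \int[m1]_x cabs (f (x, y)) = K y) ->
  m2.-integrable setT (EFin \o K) -> cintegrable (m1 \x m2)%E setT f.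
Proof.
move=> mf fi fK /integrableP[_ Ki].
apply: (cintegrable_le measurableT mf (g := fun z => cabs (f z))) => //.
apply/integrable21ltyP; first exact/measurable_EFinP/measurable_cabs.
apply: le_lt_trans Ki; rewrite le_eqVlt; apply/orP; left; apply/eqP.
apply: eq_integral => y _ /=; rewrite ger0_norm -fK ?Rintegral_ge0//; last first.
  by move=> x _; exact: cabs_ge0.
under eq_integral do rewrite ger0_norm ?cabs_ge0//.
by rewrite /Rintegral fineK//; exact: integrable_fin_num (fi y).
Qed.

Lemma integrable_tensor (u : T1 -> R) (v : T2 -> R) :
  m1.-integrable setT (EFin \o u) -> m2.-integrable setT (EFin \o v) ->
  (m1 \x m2)%E.-integrable setT (EFin \o (fun z => u z.1 * v z.2)).
Proof.
move=> ui vi.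
have uC : cintegrable m1 setT (fun x => (u x)%:C) by split => //=; exact: integrable0.
have vC : cintegrable m2 setT (fun x => (v x)%:C) by split => //=; exact: integrable0.
have [+ _] := cintegrable_tensor uC vC.
by apply: eq_integrable => // z _ /=; rewrite mul0r subr0.
Qed.

Lemma Rintegral_tensor (u : T1 -> R) (v : T2 -> R) :
  m1.-integrable setT (EFin \o u) -> m2.-integrable setT (EFin \o v) ->
  \int[(m1 \x m2)%E]_z (u z.1 * v z.2) = (\int[m1]_x u x) * \int[m2]_y v y.
Proof.
move=> ui vi; rewrite -(Rintegral_fubini1 (integrable_tensor ui vi)) /=.
by under eq_Rintegral do rewrite RintegralZl//; rewrite RintegralZr.
Qed.

End ComplexFubini.

(** * Product measures *)

Section ProductSigmaFinite.
Context d1 d2 (T1 : measurableType d1) (T2 : measurableType d2) (R : realType).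
Variables (m1 : {sigma_finite_measure set T1 -> \bar R})
          (m2 : {sigma_finite_measure set T2 -> \bar R}).

Lemma product_sigma_finite : sigma_finite setT (m1 \x m2)%E.
Proof.
have /sigma_finiteP[F [TF ndF Foo]] := sigma_finiteT m1.
have /sigma_finiteP[G [TG ndG Goo]] := sigma_finiteT m2.
exists (fun n => F n `*` G n).
  rewrite -setXTT TF TG predeqE => -[x y]; split.
    move=> [/= [n _ Fnx] [k _ Gky]]; exists (maxn n k) => //; split.
    - by move: x Fnx; exact/subsetPset/ndF/leq_maxl.
    - by move: y Gky; exact/subsetPset/ndG/leq_maxr.
  by move=> [n _ []/= ? ?]; split; exists n.
move=> k; have [? ?] := Foo k; have [? ?] := Goo k.
split; first exact: measurableX.
by rewrite product_measure1E// lte_mul_pinfty// ge0_fin_numE.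
Qed.

Let prodT : measurableType _ := (T1 * T2)%type.

Let prod_factory := Measure_isSigmaFinite.Build _ prodT _ (m1 \x m2)%E product_sigma_finite.

(** The sigma-finite structure attached to the product, so that a product can be
a factor of a further product. *)
Definition product_measure_sf : sigma_finite_measure prodT R :=
  HB.pack (m1 \x m2)%E prod_factory.

End ProductSigmaFinite.

Section Plane.
Context {R : realType}.

Definition plane : {sigma_finite_measure set (measurableTypeR R * measurableTypeR R)%type -> \bar R} :=
  product_measure_sf (@lebesgue_measure R) (@lebesgue_measure R).

Lemma planeX (A B : set (measurableTypeR R)) : measurable A -> measurable B ->
  plane (A `*` B) = (lebesgue_measure A * lebesgue_measure B)%E.
Proof. exact: product_measure1E. Qed.

End Plane.

(** * The Hilbert space of square-integrable functions on the circle *)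

Section SquareIntegrable.
Context d (T : measurableType d) (R : realType).
Variables (mu : {measure set T -> \bar R}) (D : set T).
Hypothesis mD : measurable D.
Implicit Types f g : T -> R[i].

Lemma square_integrable_cmeasurable f : square_integrable_on mu D f -> cmeasurable_fun D f.
Proof. by case. Qed.

Lemma square_integrableP f : square_integrable_on mu D f ->
  mu.-integrable D (fun x => (cabs (f x) ^+ 2)%:E).
Proof.
move=> [fr fi foo]; apply/integrableP; split.
  by apply/measurable_EFinP/measurable_funX/measurable_cabs; split.
under eq_integral do rewrite gee0_abs ?lee_fin ?sqr_ge0//.
exact: foo.
Qed.

(** [|f g| <= |f|^2 + |g|^2]. *)
Lemma square_integrableM f g : square_integrable_on mu D f -> square_integrable_on mu D g ->
  cintegrable mu D (fun x => f x * g x).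
Proof.
move=> f2 g2.
apply: (@cintegrable_le _ _ _ mu D mD _ (fun x => cabs (f x) ^+ 2 + cabs (g x) ^+ 2)).
- by apply: cmeasurableM; exact: square_integrable_cmeasurable.
- by have := integrableD mD (square_integrableP f2) (square_integrableP g2).
- move=> x _; rewrite cabsM.
  have := cabs_ge0 (f x); have := cabs_ge0 (g x); nra.
Qed.

Lemma square_integrableJ f : square_integrable_on mu D f ->
  square_integrable_on mu D (fun x => Num.conj (f x)).
Proof.
move=> [fr fi foo]; have [? ?] := cmeasurableJ (conj fr fi); split => //.
by under eq_integral do rewrite cabsJ.
Qed.

End SquareIntegrable.

#[local] Instance lebesgue_ae_filter (R : realType) :
  Filter (almost_everywhere (@lebesgue_measure R)).
Proof. exact: ae_filter_ringOfSetsType. Qed.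

Section L2Space.
Context {R : realType}.
Local Notation mu := (@lebesgue_measure R).
Local Notation arc := (circle_arc R).
Local Open Scope quotient_scope.

Lemma measurable_arc : measurable arc.
Proof. exact: measurable_itv. Qed.
Hint Resolve measurable_arc : core.

Lemma L2fun_square (f : L2fun R) : square_integrable_on mu arc (fun t => f (cis t)).
Proof. by have /asboolP := valP f. Qed.

Lemma L2_class_ae (g : unit_circle R -> R[i]) :
  square_integrable_on mu arc (fun t => g (cis t)) ->
  {ae mu, forall t : R, arc t -> repr (L2_class g) (cis t) = g (cis t)}.
Proof.
move=> g2; have := L2_reprP (insubd (0 : L2fun R) (g : unit_circle R -> R[i]^o)).
apply: filterS => t H At; rewrite (H At).
have -> // : L2fun_val (insubd (0 : L2fun R) (g : unit_circle R -> R[i]^o)) = g.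
by rewrite -[L2fun_val _]/(val _) insubdK//; apply/asboolP.
Qed.

Lemma L2_ip_integrable (u v : L2S1 R) :
  cintegrable mu arc (fun t => repr u (cis t) * Num.conj (repr v (cis t))).
Proof.
apply: square_integrableM => //; first exact: L2fun_square.
exact: (square_integrableJ (L2fun_square _)).
Qed.

(** Representatives of classes are chosen arbitrarily, so linearity holds only
almost everywhere. *)
Lemma repr_linear a (u v : L2S1 R) : {ae mu, forall t : R, arc t ->
  repr (a *: u + v) (cis t) = a * repr u (cis t) + repr v (cis t)}.
Proof.
have E : a *: u + v = \pi_(L2S1 R) (a *: repr u + repr v).
  rewrite -{1}[u]reprK -{1}[v]reprK.
  by rewrite -[a *: _]/(L2_scale _ _) pi_L2Z -[LHS]/(L2_add _ _) pi_L2D.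
have := L2_reprP (a *: repr u + repr v).
by apply: filterS => t H At; rewrite E H.
Qed.

Lemma L2_inner_product : inner_product (@L2_ip R).
Proof.
split.
- move=> a u v w; rewrite /L2_ip.
  rewrite -cintegralZ//; last exact: L2_ip_integrable.
  rewrite -cintegralD//; [|by apply: cintegrableZ => //; exact: L2_ip_integrable|exact: L2_ip_integrable].
  apply: ae_eq_cintegral => //.
  + exact: (cintegrable_measurable (L2_ip_integrable _ _)).
  + apply: cintegrable_measurable; apply: cintegrableD => //; last exact: L2_ip_integrable.
    by apply: cintegrableZ => //; exact: L2_ip_integrable.
  + apply: filterS (repr_linear a u v) => t H At; rewrite (H At).
    by rewrite mulrDl mulrA.
- move=> u v; rewrite /L2_ip -cintegralJ//; last exact: L2_ip_integrable.
  by apply: eq_cintegral => t _; rewrite conjM conjCK mulrC.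
- move=> u; apply: Rintegral_ge0 => t _.
  by rewrite mulCJ /= sqr_ge0.
- move=> u u0; rewrite -[u]reprK -[RHS]/(\pi_(L2S1 R) 0); apply/L2_eqP.
  have : (\int[mu]_(t in arc) `|(cabs (repr u (cis t)) ^+ 2)%:E| = 0)%E.
    have := square_integrableP (L2fun_square (repr u)).
    move=> /integrable_fin_num fn; rewrite -[LHS]fineK.
      move: u0; rewrite /L2_ip /cintegral/= /Rintegral => u0; congr EFin.
      rewrite -[RHS]u0; congr fine; apply: eq_integral => t _.
      by rewrite mulCJ /= ger0_norm ?sqr_ge0.
    under eq_integral do rewrite /= ger0_norm ?sqr_ge0//.
    exact: fn.
  have mf : measurable_fun arc (fun t => (cabs (repr u (cis t)) ^+ 2)%:E).
    by apply/measurable_EFinP/measurable_funX/measurable_cabs; case: (L2fun_square (repr u)).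
  move/(ae_eq_integral_abs mu measurable_arc mf).
  apply: filterS => t H At; have := H At => -[/eqP].
  by rewrite sqrf_eq0 => /eqP /Normc.eq0_normc.
Qed.

End L2Space.

(** * Integrability of the singular weight *)

Section Weight.
Context {R : realType}.
Local Notation mu := (@lebesgue_measure R).
Local Notation RR := (measurableTypeR R * measurableTypeR R)%type.
Local Notation mu2 := (@plane R).
Implicit Types (beta : R) (p : RR).

Definition planar_norm (p : RR) : R := cabs (Complex p.1 p.2).

Lemma planar_norm_sqr (p : RR) : planar_norm p ^+ 2 = p.1 ^+ 2 + p.2 ^+ 2.
Proof. by rewrite /planar_norm cabs_sqr. Qed.

Lemma planar_norm_ge0 (p : RR) : 0 <= planar_norm p. Proof. exact: cabs_ge0. Qed.

Lemma coord_le_planar_norm (p : RR) : `|p.1| <= planar_norm p /\ `|p.2| <= planar_norm p.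
Proof. by split; [exact: (Re_le_cabs (Complex p.1 p.2))|exact: (Im_le_cabs (Complex p.1 p.2))]. Qed.

Lemma measurable_planar_norm : measurable_fun setT planar_norm.
Proof.
apply: measurable_cabs; split => /=; [exact: measurable_fst|exact: measurable_snd].
Qed.

Definition weight beta (p : RR) : R := \1_[set p | planar_norm p < 1] p * planar_norm p `^ (- beta).

Lemma ball_cabs (z : R[i]^o) : ball (0 : R[i]^o) 1 z = (cabs z < 1).
Proof.
rewrite -ball_normE /ball_ /= sub0r normrN.
have -> : `|z : R[i]| = (cabs z)%:C by rewrite normc_def cabsE.
by rewrite -[1 : R[i]]/(1%:C) ltcR.
Qed.

Lemma f_betaE beta (p : RR) (w : unit_circle R) :
  f_beta beta (Complex p.1 p.2, w) = (weight beta p)%:C.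
Proof.
rewrite /f_beta /weight /= div1r -powRN; congr ((_ * _)%:C).
rewrite !indicE; congr ((nat_of_bool _)%:R); apply/idP/idP => /set_mem H; apply/mem_set.
  by move: H; rewrite ball_cabs.
by rewrite ball_cabs.
Qed.

Lemma weight_ge0 beta p : 0 <= weight beta p.
Proof. by rewrite /weight indicE mulr_ge0// powR_ge0. Qed.

Lemma measurable_weight beta : measurable_fun setT (weight beta).
Proof.
apply: measurable_funM.
  apply: measurable_indic.
  have := measurable_fun_ltr measurable_planar_norm (measurable_cst (1 : R)).
  move=> /(_ measurableT [set true] I).
  by rewrite setTI; congr measurable; apply/seteqP; split => x /=.
exact: (measurableT_comp (measurable_powR _) measurable_planar_norm).
Qed.

Definition square (k : nat) : set RR := `[(- 2^-1 ^+ k), (2^-1 ^+ k)] `*` `[(- 2^-1 ^+ k), (2^-1 ^+ k)].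

Lemma measurable_square k : measurable (square k).
Proof. by apply: measurableX; exact: measurable_itv. Qed.

Lemma measurable_indic_square k : measurable_fun setT (\1_(square k) : RR -> R).
Proof. by apply: measurable_indic; exact: measurable_square. Qed.

Lemma square_measure k : mu2 (square k) = ((2 * 2^-1 ^+ k) ^+ 2)%:E.
Proof.
rewrite /square planeX; [|exact: measurable_itv..].
have k0 : 0 < 2^-1 ^+ k :> R by rewrite exprn_gt0.
have E : lebesgue_measure (`[(- 2^-1 ^+ k), (2^-1 ^+ k)] : set R) = (2 * 2^-1 ^+ k)%:E.
  rewrite lebesgue_measure_itv/= lte_fin ifT; last by lra.
  by rewrite -EFinB; congr (_%:E); ring.
by rewrite expr2 EFinM; congr (_ * _)%E; exact: E.
Qed.

Lemma in_square k p : planar_norm p <= 2^-1 ^+ k -> p \in square k.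
Proof.
move=> rk; have [h1 h2] := coord_le_planar_norm p; apply/mem_set; split => /=.
  by rewrite in_itv/= -ler_norml (le_trans h1).
by rewrite in_itv/= -ler_norml (le_trans h2).
Qed.

Lemma dyadic_scale (r : R) : 0 < r < 1 -> exists k : nat, 2^-1 ^+ k.+1 <= r < 2^-1 ^+ k.
Proof.
move=> /andP[r0 r1].
have ex : exists k : nat, 2^-1 ^+ k <= r.
  have : (@geometric R 1 2^-1) @ \oo --> 0.
    by apply: cvg_geometric; rewrite ger0_norm ?invr_ge0// invf_lt1// ltr1n.
  move=> /cvgrPdist_lt/(_ r r0) [k _ /(_ k (leqnn k))].
  rewrite /= sub0r normrN mul1r ger0_norm ?exprn_ge0 ?invr_ge0// => /ltW ?.
  by exists k.
have := ex_minnP ex => -[[|k]]; first by rewrite expr0 leNgt r1.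
move=> kr kmin; exists k; rewrite kr /= ltNge; apply/negP => /kmin.
by rewrite ltnn.
Qed.

(** The supremum of [r^(-2 beta)] grows by the factor [4^beta] from one dyadic
annulus to the next inner one; the maximum with 0 keeps the ratio at least 1,
so that a nonpositive [beta], for which the weight is bounded, is covered too. *)
Definition dyadic_ratio beta : R := 4 `^ Num.max beta 0.

Lemma dyadic_ratio_lt beta : beta < 1 -> 1 <= dyadic_ratio beta < 4.
Proof.
move=> b1; rewrite /dyadic_ratio; set b := Num.max _ _.
have b0 : 0 <= b by rewrite le_max lexx orbT.
rewrite -{1}(powRr0 (4 : R)) ler_powR ?ler1n//=.
rewrite /powR pnatr_eq0/= -[ltRHS]lnK ?posrE// ltr_expR -[ltRHS]mul1r.
by rewrite ltr_pM2r ?ln_gt0 ?ltr1n// gt_max b1 /=.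
Qed.

(** A point of the annulus [2^-(k+1) <= r < 2^-k] lies in the square of index
[k], and there the squared weight is at most [4^(b (k+1))] with
[b = max beta 0].  The other terms of the series are nonnegative. *)
Lemma weight_sqr_le beta p : beta < 1 ->
  ((weight beta p ^+ 2)%:E <=
   \sum_(0 <= k <oo) (dyadic_ratio beta ^+ k.+1 * \1_(square k) p)%:E)%E.
Proof.
move=> b1; have /andP[c1 c4] := dyadic_ratio_lt b1.
set C := dyadic_ratio beta in c1 c4 *.
suff [k [H kp]] : exists k, weight beta p ^+ 2 <= C ^+ k.+1 /\
    (weight beta p != 0 -> p \in square k).
  have nn j : (0 <= (C ^+ j.+1 * \1_(square j) p)%:E)%E.
    by rewrite lee_fin mulr_ge0// exprn_ge0// (le_trans ler01).
  have [->|w0] := eqVneq (weight beta p) 0.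
    by rewrite expr0n; apply: nneseries_ge0 => n _ _; exact: nn.
  apply: (@le_trans _ _ (\sum_(0 <= j < k.+1) (C ^+ j.+1 * \1_(square j) p)%:E)%E); last first.
    by apply: nneseries_lim_ge => n _ _; exact: nn.
  rewrite big_nat_recr//= indicE kp// mulr1; apply: (@le_trans _ _ (C ^+ k.+1)%:E).
    by rewrite lee_fin.
  by rewrite leeDr// sume_ge0.
have [r1|r1] := ltP (planar_norm p) 1; last first.
  exists 0%N; rewrite /weight indicE memNset ?mul0r ?expr0n ?eqxx/=; last first.
    by rewrite /= ltNge r1.
  by split => //; rewrite expr1 (le_trans ler01).
have wE : weight beta p = planar_norm p `^ (- beta) by rewrite /weight indicE mem_set ?mul1r.
have [r0|r0] := eqVneq (planar_norm p) 0.
  exists 0%N; split; last by move=> _; apply: in_square; rewrite r0 expr0.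
  rewrite expr1 wE r0; have [->|n0] := eqVneq beta 0.
    by rewrite oppr0 powRr0 expr1n.
  by rewrite powR0 ?oppr_eq0// expr0n (le_trans ler01).
have rp : 0 < planar_norm p by rewrite lt_def r0 planar_norm_ge0.
have [|k /andP[k1 k2]] := @dyadic_scale (planar_norm p); first by rewrite rp r1.
exists k; split; last by move=> _; apply: in_square; exact: ltW.
rewrite wE.
pose b := Num.max beta 0; have b0 : 0 <= b by rewrite le_max lexx orbT.
apply: (@le_trans _ _ ((planar_norm p `^ (- b)) ^+ 2)).
  rewrite ler_pXn2r ?nnegrE ?powR_ge0//; apply: ger_powR; first by rewrite rp ltW.
  by rewrite lerN2 le_max lexx.
have -> : C ^+ k.+1 = ((2^-1 ^+ k.+1) `^ (- b)) ^+ 2.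
  have CE : C = (2 `^ b) ^+ 2.
    by rewrite /C /dyadic_ratio -/b expr2 -powRM// -natrM.
  by rewrite exprVn -powR_invn// -powRrM mulrNN mulrC powRrM powR_mulrn ?powR_ge0// CE exprAC.
rewrite ler_pXn2r ?nnegrE ?powR_ge0//.
rewrite !powRN lef_pV2 ?posrE ?powR_gt0 ?exprn_gt0//.
by apply: ge0_ler_powR; rewrite ?nnegrE ?exprn_ge0 ?(ltW rp).
Qed.

(** The square of index [k] has area [4 4^-k], so the dominating series is
geometric of ratio [4^max(beta, 0) / 4 < 1]. *)
Lemma weight_sqr_integral beta : beta < 1 ->
  (\int[mu2]_p (weight beta p ^+ 2)%:E < +oo)%E.
Proof.
move=> b1; have /andP[c1 c4] := dyadic_ratio_lt b1.
have c0 : 0 <= dyadic_ratio beta by rewrite (le_trans ler01).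
have m1 k : measurable_fun setT (fun p : RR => (dyadic_ratio beta ^+ k.+1 * \1_(square k) p)%:E).
  apply/measurable_EFinP/measurable_funM; first exact: measurable_cst.
  exact: measurable_indic_square.
have n1 k (p : RR) : (0 <= (dyadic_ratio beta ^+ k.+1 * \1_(square k) p)%:E)%E.
  by rewrite lee_fin mulr_ge0// exprn_ge0.
apply: (@le_lt_trans _ _ (\int[mu2]_p
   \sum_(0 <= k <oo) (dyadic_ratio beta ^+ k.+1 * \1_(square k) p)%:E)%E).
  apply: ge0_le_integral => //.
  - by move=> p _; rewrite lee_fin sqr_ge0.
  - by apply/measurable_EFinP; apply: measurable_funX; exact: measurable_weight.
  - exact: (@ge0_emeasurable_sum _ _ _ _ _ xpredT (fun k p _ _ => n1 k p) (fun k _ => m1 k)).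
  - by move=> p _; exact: weight_sqr_le.
rewrite integral_nneseries//.
have E k : (\int[mu2]_p (dyadic_ratio beta ^+ k.+1 * \1_(square k) p)%:E =
   (geometric (4 * dyadic_ratio beta) (dyadic_ratio beta / 4) k)%:E)%E.
  under eq_integral do rewrite EFinM.
  rewrite ge0_integralZl//; last 2 first.
  - by apply/measurable_EFinP; exact: measurable_indic_square.
  - by rewrite lee_fin exprn_ge0.
  rewrite integral_indic//; last exact: measurable_square.
  rewrite setIT [X in (_ * X)%E]square_measure -EFinM /=; congr (_%:E).
  have -> : (2 * 2^-1 ^+ k) ^+ 2 = 4 * 4^-1 ^+ k :> R.
    by rewrite exprMn exprAC [2^-1 ^+ 2]exprVn -natrX.
  by rewrite exprS [in RHS]exprMn; ring.
under eq_eseriesr do rewrite E.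
have z1 : `|dyadic_ratio beta / 4| < 1.
  by rewrite ger0_norm ?divr_ge0// ltr_pdivrMr// mul1r.
have := cvg_geometric_series (a := 4 * dyadic_ratio beta) z1.
move=> /cvg_lim lE.
rewrite (_ : limn _ = (4 * dyadic_ratio beta * (1 - dyadic_ratio beta / 4)^-1)%:E) ?ltry//.
rewrite -(lE (@Rhausdorff R)) -EFin_lim; last exact: is_cvg_geometric_series.
by congr (limn _); apply/funext => n /=; rewrite /series /= sumEFin.
Qed.

(** On the unit disc, [w <= 1 + w^2]. *)
Lemma integrable_weight beta : beta < 1 -> mu2.-integrable setT (EFin \o weight beta).
Proof.
move=> b1; apply/integrableP; split; first by apply/measurable_EFinP; exact: measurable_weight.
apply: (@le_lt_trans _ _ (\int[mu2]_p ((\1_(square 0) p)%:E + (weight beta p ^+ 2)%:E))%E).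
  apply: ge0_le_integral => //.
  - by apply: measurableT_comp => //; apply/measurable_EFinP; exact: measurable_weight.
  - apply: emeasurable_funD; first by apply/measurable_EFinP; exact: measurable_indic_square.
    by apply/measurable_EFinP; apply: measurable_funX; exact: measurable_weight.
  - move=> p _; rewrite /= ger0_norm ?weight_ge0// -EFinD lee_fin.
    have [r1|r1] := ltP (planar_norm p) 1.
      rewrite indicE in_square ?expr0 ?ltW//; have := weight_ge0 beta p; rewrite /=; nra.
    rewrite {1}/weight indicE memNset ?mul0r ?addr_ge0 ?sqr_ge0//.
    by rewrite /= ltNge r1.
rewrite ge0_integralD//; last 3 first.
- by apply/measurable_EFinP; exact: measurable_indic_square.
- by move=> p _; rewrite lee_fin sqr_ge0.
- by apply/measurable_EFinP; apply: measurable_funX; exact: measurable_weight.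
rewrite integral_indic//; last exact: measurable_square.
rewrite setIT [X in (X + _)%E]square_measure lte_add_pinfty ?ltry//.
exact: weight_sqr_integral.
Qed.

End Weight.

(** * Square integrability and compact support on the motion group *)

Section Support.
Context {R : realType}.
Local Notation mu := (@lebesgue_measure R).
Local Notation arc := (circle_arc R).
Local Notation RR := (measurableTypeR R * measurableTypeR R)%type.
Local Notation mu2 := (@plane R).

Lemma integrable_arc : cintegrable mu setT (fun t : R => (\1_arc t)%:C).
Proof.
split; last exact: integrable0.
by apply: integrable_indic_itv.
Qed.

Lemma f_beta_square_integrable (beta : R) : beta < 1 -> M2_square_integrable (f_beta beta).
Proof.
move=> b1.
have mch : measurable (@M2_chart R) by apply: measurableX => //; exact: (@measurable_arc R).
have fE p : f_beta beta (M2_coord p) = (weight beta p.1)%:C by exact: f_betaE.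
have mw : measurable_fun setT (fun p : RR * measurableTypeR R => weight beta p.1).
  exact: (measurableT_comp (measurable_weight beta) measurable_fst).
split.
- by apply: measurable_funTS; under eq_fun do rewrite fE.
- by apply: measurable_funTS; under eq_fun do rewrite fE; exact: measurable_cst.
rewrite integral_mkcond.
have wi : mu2.-integrable setT (EFin \o (fun p => weight beta p ^+ 2)).
  apply/integrableP; split; first by apply/measurable_EFinP/measurable_funX; exact: measurable_weight.
  under eq_integral do rewrite /= ger0_norm ?sqr_ge0//.
  exact: weight_sqr_integral.
have [/integrableP[_]] := @cintegrable_tensor _ _ RR (measurableTypeR R) R mu2 mu _ _ (cintegrable_real wi) integrable_arc.
move=> + _; apply: le_lt_trans; apply: ge0_le_integral => //.
- by move=> p _; apply: erestrict_ge0 => q _; rewrite lee_fin sqr_ge0.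
- apply/(measurable_restrictT _ mch)/measurable_funTS/measurable_EFinP/measurable_funX.
  rewrite (_ : (fun x => _) = (fun p : RR * measurableTypeR R => weight beta p.1))//.
  by apply/funext => p; rewrite fE cabs_real ger0_norm ?weight_ge0.
- apply/measurableT_comp => //; apply/measurable_EFinP.
  under eq_fun do rewrite Re_realM.
  apply: measurable_funM; first exact: measurable_funX.
  exact: (measurableT_comp (measurable_indic measurable_arc) measurable_snd).
move=> p _; rewrite patchE; case: ifPn => pch /=; last by rewrite lee_fin.
rewrite -[leLHS]/((cabs (f_beta beta (M2_coord p)) ^+ 2)%:E).
rewrite fE cabs_real ger0_norm ?weight_ge0//= indicE mem_set ?mulr1 ?mul0r ?subr0.
  by rewrite lee_fin ler_norm.
by move/set_mem : pch => -[].
Qed.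

Lemma continuous_Complex : continuous (fun p : R * R => Complex p.1 p.2 : R[i]^o).
Proof.
move=> p; apply/cvgrPdist_lt => -[e e0]; rewrite ltcE /= => /andP[/eqP -> ep].
have e2 : 0 < e / 2 by rewrite divr_gt0.
have H1 : \forall q \near p, `|p.1 - q.1| < e / 2.
  by have /cvgrPdist_lt/(_ _ e2) : (fst : R * R -> R) q @[q --> p] --> p.1 by exact: cvg_fst.
have H2 : \forall q \near p, `|p.2 - q.2| < e / 2.
  by have /cvgrPdist_lt/(_ _ e2) : (snd : R * R -> R) q @[q --> p] --> p.2 by exact: cvg_snd.
near=> q.
rewrite normCE -[Complex e 0]/(e%:C) ltcR.
apply: (le_lt_trans (cabs_le_ReIm _)); rewrite ReD ImD /=.
have h1 : `|p.1 - q.1| < e / 2 by near: q; exact: H1.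
have h2 : `|p.2 - q.2| < e / 2 by near: q; exact: H2.
by rewrite (splitr e) ltrD.
Unshelve. all: by end_near. Qed.

Lemma continuous_of_contraction (g : R[i] -> R) :
  (forall x y, `|g x - g y| <= cabs (x - y)) -> continuous (g : R[i]^o -> R).
Proof.
move=> gl z; have FF := @nbhs_filter (R[i]^o) z.
apply/cvgrPdist_lt => e e0.
have eC : 0 < e%:C :> R[i] by rewrite ltcR.
have /cvgrPdist_lt/(_ _ eC) : (id : R[i]^o -> R[i]^o) w @[w --> (z : R[i]^o)] --> (z : R[i]^o).
  exact: cvg_id.
by apply: filterS => w; rewrite normCE ltcR; apply: le_lt_trans; exact: gl.
Qed.

Lemma continuous_cis : continuous (@cis R).
Proof.
apply: continuous_comp_initial => t.
have : (fun s : R => Complex (cos s) (sin s) : R[i]^o) =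
  (fun p : R * R => Complex p.1 p.2 : R[i]^o) \o (fun s => (cos s, sin s)) by [].
rewrite /= => E; rewrite /continuous_at.
apply: (@continuous_comp _ _ _ (fun s : R => (cos s, sin s)) (fun p : R * R => Complex p.1 p.2 : R[i]^o)).
  exact: (cvg_pair (@continuous_cos R t) (@continuous_sin R t)).
exact: continuous_Complex.
Qed.

Lemma cis_surj (w : unit_circle R) : exists2 t : R, - pi <= t <= pi & cis t = w.
Proof.
have := cval_norm w; rewrite normCE => /(congr1 (@complex.Re R)) /=.
case E : (cval w) => [x y] => /(congr1 (fun r => r ^+ 2)).
rewrite cabs_sqr expr1n /= => xy1.
have x1 : -1 <= x <= 1 by rewrite -ler_norml -(@ler_pXn2r _ 2) ?nnegrE// expr1n real_normK ?num_real//; nra.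
have a0 := acos_ge0 x1; have api := acos_lepi x1.
have sE : sin (acos x) = `|y|.
  by rewrite sin_acos// -(sqrtr_sqr y); congr Num.sqrt; lra.
have [y0|y0] := leP 0 y.
  exists (acos x); first by rewrite api andbT (le_trans _ a0)// oppr_le0 ltW ?pi_gt0.
  by apply/val_inj; rewrite /= acosK// sE ger0_norm// -E.
exists (- acos x); first by rewrite lerN2 api /= (le_trans _ (ltW (pi_gt0 R)))// oppr_le0.
by apply/val_inj; rewrite /= cosN sinN acosK// sE ltr0_norm// opprK -E.
Qed.

(** The support lies in a box times the circle, which is compact as a continuous
image of a product of segments. *)
Lemma f_beta_compactly_supported (beta : R) : compactly_supported (f_beta beta).
Proof.
rewrite /compactly_supported.
pose I := `[-1, 1]%classic : set R.
pose K : set (M2 R) := ((fun p : R * R => Complex p.1 p.2 : R[i]^o) @` (I `*` I)) `*`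
  (@cis R @` (`[- pi, pi]%classic : set R)).
have cK : compact K.
  apply: compact_setX; apply: continuous_compact.
  - exact/continuous_subspaceT/continuous_Complex.
  - by apply: compact_setX; exact: segment_compact.
  - exact/continuous_subspaceT/continuous_cis.
  - exact: segment_compact.
apply: (subclosed_compact _ cK); first exact: closed_closure.
(* The closure is taken inside a closed set defined by inequalities on the two
   coordinates, which is then seen to lie in the compact image [K]. *)
pose J : set (M2 R) := ((fun m => complex.Re m.1) @^-1` I) `&` ((fun m => complex.Im m.1) @^-1` I).
have cJ : closed J.
  have cfst (m : M2 R) : {for m, continuous (fst : M2 R -> R[i]^o)} by exact: cvg_fst.
  have cRe : continuous (@complex.Re R : R[i]^o -> R).
    apply: continuous_of_contraction => x y.
    by have := Re_le_cabs (x - y); case: x y => [? ?] [? ?].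
  have cIm : continuous (@complex.Im R : R[i]^o -> R).
    apply: continuous_of_contraction => x y.
    by have := Im_le_cabs (x - y); case: x y => [? ?] [? ?].
  apply: closedI; apply: closed_comp; try exact: itv_closed; move=> m _.
    exact: (continuous_comp (cfst m) (cRe m.1)).
  exact: (continuous_comp (cfst m) (cIm m.1)).
apply: (@subset_trans _ J).
  rewrite [X in _ `<=` X](closure_id J).1//; apply: closureS => m /= fm.
  have : cabs m.1 < 1.
    rewrite ltNge; apply/negP => m1; move: fm; rewrite /f_beta indicE memNset ?mul0r ?eqxx//.
    by rewrite /= ball_cabs ltNge m1.
  move=> m1; split; rewrite /= /I /= in_itv/= -ler_norml.
    by rewrite (le_trans (Re_le_cabs _))// ltW.
  by rewrite (le_trans (Im_le_cabs _))// ltW.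
move=> [[x y] w] [/= xI yI]; split => /=; first by exists (x, y).
by have [t t1 <-] := cis_surj w; exists t => //=; rewrite in_itv.
Qed.

End Support.

(** * Translates of functions on the circle *)

Section CircleFunctions.
Context {R : realType}.
Local Notation mu := (@lebesgue_measure R).
Local Notation arc := (circle_arc R).

Lemma cis_periodic (t : R) : cis (t + 2 * pi) = cis t.
Proof.
apply/val_inj => /=.
by rewrite (_ : 2 * pi = pi *+ 2) ?mulr2n ?mulrDl ?mul1r// -mulr2n sinD2pi cosD2pi.
Qed.

Lemma circle_div_cis (t s : R) : circle_div (cis t) (cis s) = cis (t - s).
Proof.
apply/val_inj => /=; apply: (can_inj (mulfK (_ : Complex (cos s) (sin s) != 0))).
  apply/negP => /eqP[c0 s0]; have := cos2Dsin2 s; rewrite c0 s0 expr0n addr0 => /eqP.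
  by rewrite eq_sym oner_eq0.
rewrite divfK; last first.
  apply/negP => /eqP[c0 s0]; have := cos2Dsin2 s; rewrite c0 s0 expr0n addr0 => /eqP.
  by rewrite eq_sym oner_eq0.
have : t = t - s + s by rewrite subrK.
move: (t - s) => w ->.
by apply/eqP; rewrite eq_complex /= cosD sinD; apply/andP; split; apply/eqP; ring.
Qed.

Lemma cabs_cval (w : unit_circle R) : cabs (cval w) = 1.
Proof. by have := cval_norm w; rewrite normCE => /(congr1 (@complex.Re R)). Qed.

Lemma L2fun_cmeasurable (g : L2fun R) : cmeasurable_fun setT (fun t => g (cis t)).
Proof.
have [gr gi _] := L2fun_square g; split.
  apply: (@periodic_measurable R _ _ (fun t => complex.Re (g (cis t)))) gr => s.
  by rewrite cis_periodic.
apply: (@periodic_measurable R _ _ (fun t => complex.Im (g (cis t)))) gi => s.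
by rewrite cis_periodic.
Qed.

Lemma bounded_square_integrable (f : R -> R[i]) (k : R) :
  cmeasurable_fun arc f -> (forall t, arc t -> cabs (f t) <= k) ->
  square_integrable_on mu arc f.
Proof.
move=> mf fk; have [fr fi] := mf; split => //.
apply: (@le_lt_trans _ _ (\int[mu]_(t in arc) (k ^+ 2)%:E)%E).
  apply: ge0_le_integral => //.
  - exact: measurable_arc.
  - by move=> t _; rewrite lee_fin sqr_ge0.
  - by apply/measurable_EFinP/measurable_funX/measurable_cabs.
  - move=> t At; rewrite lee_fin; have := fk _ At; have := cabs_ge0 (f t); nra.
rewrite integral_cst; last exact: measurable_arc.
by rewrite -[X in (_ * X)%E]/(mu arc) arc_measure -EFinM ltry.
Qed.

Lemma square_integrable_cintegrable (f : R -> R[i]) : square_integrable_on mu arc f ->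
  cintegrable mu arc f.
Proof.
move=> f2; have o2 : square_integrable_on mu arc (fun=> 1 : R[i]).
  apply: (@bounded_square_integrable _ 1); first by split; exact: measurable_cst.
  by move=> t _; rewrite -[1]/(1%:C) cabs_real normr1.
have [ir ii] := @square_integrableM _ (measurableTypeR R) R mu _ (@measurable_arc R) _ _ f2 o2.
split.
  by apply: eq_integrable ir => [|t _ /=]; rewrite ?mulr1//; exact: measurable_arc.
by apply: eq_integrable ii => [|t _ /=]; rewrite ?mulr1//; exact: measurable_arc.
Qed.

Lemma reflect_integrable (v : R -> R) (t : R) : measurable_fun setT v ->
  (forall s, v (s + 2 * pi) = v s) ->
  mu.-integrable arc (EFin \o v) -> mu.-integrable arc (EFin \o (fun s => v (t - s))).
Proof.
move=> mv vp /integrableP[_ vi]; apply/integrableP; split.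
  apply/measurable_EFinP/measurable_funTS/(measurableT_comp mv).
  by apply: measurable_funB => //; exact: measurable_cst.
rewrite /= (periodic_integral_reflect (v := fun s => `|(v s)%:E|%E) t)//.
- by apply: measurableT_comp => //; exact/measurable_EFinP.
- by move=> s; rewrite vp.
Qed.

Lemma cintegrable_reflect (g : L2fun R) (t : R) :
  cintegrable mu arc (fun s => g (cis (t - s))).
Proof.
have [gr gi] := square_integrable_cintegrable (L2fun_square g).
have [mr mi] := L2fun_cmeasurable g.
split.
  by apply: (reflect_integrable t mr _ gr) => s; rewrite cis_periodic.
by apply: (reflect_integrable t mi _ gi) => s; rewrite cis_periodic.
Qed.

Lemma cintegral_reflect (g : L2fun R) (t : R) :
  cintegral mu arc (fun s => g (cis (t - s))) = cintegral mu arc (fun s => g (cis s)).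
Proof.
have [mr mi] := L2fun_cmeasurable g.
rewrite /cintegral; congr Complex.
  by rewrite (periodic_Rintegral_reflect t mr)// => s; rewrite cis_periodic.
by rewrite (periodic_Rintegral_reflect t mi)// => s; rewrite cis_periodic.
Qed.

Lemma square_integrable_shift (g : L2fun R) (c : R) : - pi <= c <= pi ->
  square_integrable_on mu arc (fun s => g (cis (s - c))).
Proof.
move=> /andP[c1 c2]; have mg := L2fun_cmeasurable g; have [mr mi] := mg.
have ms : measurable_fun setT (fun s : R => s - c).
  by apply: measurable_funB => //; exact: measurable_cst.
split.
- by apply: measurable_funTS; exact: (measurableT_comp mr ms).
- by apply: measurable_funTS; exact: (measurableT_comp mi ms).
rewrite (periodic_integral_shift (v := fun s => (cabs (g (cis s)) ^+ 2)%:E) (c := - c))//.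
- by have [] := L2fun_square g.
- by apply/measurable_EFinP/measurable_funX/measurable_cabs.
- by move=> s; rewrite lee_fin sqr_ge0.
- by move=> s; rewrite cis_periodic.
- by apply/andP; split; lra.
Qed.

End CircleFunctions.

(** * The group Fourier transform of a function of the translation part *)

Section RotationInvariant.
Context {R : realType}.
Local Notation mu := (@lebesgue_measure R).
Local Notation arc := (circle_arc R).
Local Notation RR := (measurableTypeR R * measurableTypeR R)%type.
Local Notation RRR := (RR * measurableTypeR R)%type.
Local Notation mu2 := (@plane R).
Local Notation mu3 := (product_measure_sf (@plane R) (@lebesgue_measure R)).

Variables (u : RR -> R[i]) (a : R).
Hypothesis ui : cintegrable mu2 setT u.

Let mu_u : cmeasurable_fun setT u := cintegrable_measurable ui.

Definition phase (t : R) (p : RR) : R := a * (cos t * p.1 - sin t * p.2).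

Definition plane_wave (t : R) (p : RR) : R[i] := Complex (cos (phase t p)) (sin (phase t p)).

Lemma plane_waveE (t : R) (p : RR) :
  cval (cis (complex.Re (a%:C * cval (cis t) * Complex p.1 p.2))) = plane_wave t p.
Proof.
have -> // : complex.Re (a%:C * cval (cis t) * Complex p.1 p.2) = phase t p.
by rewrite /phase /=; ring.
Qed.

Lemma cabs_plane_wave t p : cabs (plane_wave t p) = 1.
Proof. by rewrite -plane_waveE cabs_cval. Qed.

Let mcos : measurable_fun setT (@cos R : measurableTypeR R -> measurableTypeR R).
Proof. exact: continuous_measurable_fun (@continuous_cos R). Qed.
Let msin : measurable_fun setT (@sin R : measurableTypeR R -> measurableTypeR R).
Proof. exact: continuous_measurable_fun (@continuous_sin R). Qed.

Lemma cmeasurable_plane_wave d (T : measurableType d) (tau : T -> measurableTypeR R) (pp : T -> RR) :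
  measurable_fun setT tau -> measurable_fun setT pp ->
  cmeasurable_fun setT (fun x => plane_wave (tau x) (pp x)).
Proof.
move=> mtau mpp.
have mph : measurable_fun setT (fun x => phase (tau x) (pp x) : measurableTypeR R).
  apply: measurable_funM; first exact: measurable_cst.
  apply: measurable_funB; apply: measurable_funM.
  - exact: (measurableT_comp mcos mtau).
  - exact: (measurableT_comp measurable_fst mpp).
  - exact: (measurableT_comp msin mtau).
  - exact: (measurableT_comp measurable_snd mpp).
split; [exact: (measurableT_comp mcos mph)|exact: (measurableT_comp msin mph)].
Qed.

(** The phase [Re (a x z)] is the scalar product of [z] with the conjugate of
[a x], so this is the plane Fourier transform of [u] on the circle of radius
[a], up to conjugation and sign. *)
Definition plane_fourier (x : unit_circle R) : R[i] :=
  cintegral mu2 setT (fun p => u p * cval (cis (complex.Re (a%:C * cval x * Complex p.1 p.2)))).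

Lemma plane_fourierE t : plane_fourier (cis t) = cintegral mu2 setT (fun p => u p * plane_wave t p).
Proof. by apply: eq_cintegral => p _; rewrite plane_waveE. Qed.

Lemma wave_integrable t : cintegrable mu2 setT (fun p => u p * plane_wave t p).
Proof.
apply: (cintegrable_le measurableT _ (cintegrable_cabs measurableT ui)).
  by apply: cmeasurableM => //; apply: cmeasurable_plane_wave; [exact: measurable_cst|exact: measurable_id].
by move=> p _; rewrite cabsM cabs_plane_wave mulr1.
Qed.

Lemma cabs_cintegral_le d (T : measurableType d) (m : {measure set T -> \bar R}) (f : T -> R[i]) :
  cintegrable m setT f -> cabs (cintegral m setT f) <= 2 * \int[m]_x cabs (f x).
Proof.
move=> fi; have ci := cintegrable_cabs measurableT fi; have [fr fim] := fi.
have B (g : T -> R) : m.-integrable setT (EFin \o g) -> (forall x, `|g x| <= cabs (f x)) ->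
    `|\int[m]_x g x| <= \int[m]_x cabs (f x).
  move=> gi gf; apply: (le_trans (le_normr_Rintegral _ gi)) => //.
  by apply: le_Rintegral => //; apply/(integrable_norm gi).
apply: (le_trans (cabs_le_ReIm _)); rewrite mulr_natl mulr2n /=.
by apply: lerD; apply: B => // x; [exact: Re_le_cabs|exact: Im_le_cabs].
Qed.

(** Bounded, hence square integrable; measurability in the angle comes from
Fubini applied to [u(z) e^(i Re (a e^(it) z))] on the plane times the arc. *)
Lemma plane_fourier_square : square_integrable_on mu arc (fun t => plane_fourier (cis t)).
Proof.
apply: (@bounded_square_integrable _ _ (2 * \int[mu2]_p cabs (u p))).
  have h : cintegrable (mu2 \x mu)%E setT
      (fun z : RRR => (u z.1 * (\1_arc z.2)%:C) * plane_wave z.2 z.1).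
    have uarc := cintegrable_tensor ui (@integrable_arc R).
    apply: (cintegrable_le measurableT _ (cintegrable_cabs measurableT uarc)).
      apply: cmeasurableM; first exact: cintegrable_measurable uarc.
      by apply: cmeasurable_plane_wave; [exact: measurable_snd|exact: measurable_fst].
    by move=> z _; rewrite cabsM cabs_plane_wave mulr1.
  have [mr mi] := cmeasurable_fubini2 h.
  have E (t : R) : arc t -> cintegral mu2 setT (fun p => u p * (\1_arc t)%:C * plane_wave t p) =
      plane_fourier (cis t).
    move=> At; rewrite plane_fourierE; apply: eq_cintegral => p _.
    by rewrite indicE mem_set// mulr1.
  split.
    apply: (eq_measurable_fun _ _ (measurable_funTS mr)) => t /set_mem At.
    by rewrite -E.
  apply: (eq_measurable_fun _ _ (measurable_funTS mi)) => t /set_mem At.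
  by rewrite -E.
move=> t _; rewrite plane_fourierE; apply: (le_trans (cabs_cintegral_le (wave_integrable t))).
by under eq_Rintegral do rewrite cabsM cabs_plane_wave mulr1.
Qed.

Section Kernel.
Variables (g h : L2S1 R).

Local Notation G := (fun t => repr g (cis t)).
Local Notation H := (fun t => Num.conj (repr h (cis t))).

(** The integrand of [int f(m) <pi_a(m) g, h> dm] with the scalar product
written out, at a point [((z, phi), theta)], extended by 0 outside the arcs so
that all integrals run over full spaces. *)
Definition kernel (z : RRR * measurableTypeR R) : R[i] :=
  ((\1_arc z.2)%:C * H z.2) *
  ((u z.1.1 * plane_wave z.2 z.1.1) * ((\1_arc z.1.2)%:C * G (z.2 - z.1.2))).

Let mG : cmeasurable_fun setT G := L2fun_cmeasurable (repr g).

Let H2 : square_integrable_on mu arc H.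
Proof. exact: (square_integrableJ (L2fun_square _)). Qed.

Let Hi : cintegrable mu setT (fun t => (\1_arc t)%:C * H t).
Proof. apply: cintegrable_mkcond; [exact: measurable_arc|exact: square_integrable_cintegrable]. Qed.

Let Gi t : cintegrable mu setT (fun s => (\1_arc s)%:C * G (t - s)).
Proof. apply: cintegrable_mkcond; [exact: measurable_arc|exact: cintegrable_reflect]. Qed.

Lemma cmeasurable_kernel : cmeasurable_fun setT kernel.
Proof.
have marc : cmeasurable_fun setT (fun t : measurableTypeR R => (\1_arc t : R)%:C).
  have mi : measurable_fun setT (\1_arc : measurableTypeR R -> R).
    by apply: measurable_indic; exact: measurable_arc.
  exact: (cmeasurable_real mi).
have m1 : measurable_fun setT (fun z : RRR * measurableTypeR R => z.1.1).
  exact: (measurableT_comp measurable_fst measurable_fst).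
have m2 : measurable_fun setT (fun z : RRR * measurableTypeR R => z.1.2).
  exact: (measurableT_comp measurable_snd measurable_fst).
have m3 : measurable_fun setT (fun z : RRR * measurableTypeR R => z.2) by exact: measurable_snd.
apply: cmeasurableM; first exact: (cmeasurable_comp (cintegrable_measurable Hi) m3).
apply: cmeasurableM; first apply: cmeasurableM.
- exact: (cmeasurable_comp mu_u m1).
- exact: cmeasurable_plane_wave.
apply: cmeasurableM; first exact: (cmeasurable_comp marc m2).
by apply: (cmeasurable_comp mG (phi := fun z : RRR * measurableTypeR R => z.2 - z.1.2)); exact: measurable_funB.
Qed.

Lemma kernel_slice_integrable t : cintegrable mu3 setT (fun P => kernel (P, t)).
Proof.
exact: (cintegrableZ measurableT ((\1_arc t)%:C * H t)
  (cintegrable_tensor (wave_integrable t) (Gi t))).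
Qed.

(** For fixed [theta] the modulus factors over [z] and [phi], and its integral is
[|h(theta)|] times a constant, by periodicity in [phi]. *)
Lemma kernel_integrable : cintegrable (mu3 \x mu)%E setT kernel.
Proof.
pose K1 := \int[mu2]_p cabs (u p).
pose K2 := \int[mu]_s (\1_arc s * cabs (G s)).
apply: (@cintegrable_tonelli2 _ _ _ _ _ _ _ kernel
  (fun t => cabs ((\1_arc t)%:C * H t) * (K1 * K2))).
- exact: cmeasurable_kernel.
- by move=> t; exact: (cintegrable_cabs measurableT (kernel_slice_integrable t)).
- move=> t.
  have i1 := cintegrable_cabs measurableT (wave_integrable t).
  have i2 := cintegrable_cabs measurableT (Gi t).
  transitivity (\int[mu3]_P (cabs ((\1_arc t)%:C * H t) *
     (cabs (u P.1 * plane_wave t P.1) * cabs ((\1_arc P.2)%:C * G (t - P.2))))).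
    by apply: eq_Rintegral => P _; rewrite /kernel !cabsM.
  rewrite RintegralZl//; last exact: (integrable_tensor i1 i2).
  rewrite (Rintegral_tensor i1 i2); congr (_ * (_ * _)).
    by apply: eq_Rintegral => p _; rewrite cabsM cabs_plane_wave mulr1.
  have E (s t' : R) : cabs ((\1_arc s)%:C * G t') = \1_arc s * cabs (G t').
    by rewrite cabsM cabs_real ger0_norm.
  under eq_Rintegral do rewrite E.
  rewrite /K2 -(restrict_indic arc (fun s => cabs (G (t - s)))) -(restrict_indic arc (fun s => cabs (G s))).
  rewrite -!Rintegral_mkcond.
  rewrite (periodic_Rintegral_reflect (v := fun s => cabs (G s)) t)//.
    exact: measurable_cabs.
  by move=> s; rewrite cis_periodic.
- have := integrableZr measurableT (K1 * K2) (cintegrable_cabs measurableT Hi).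
  by [].
Qed.

(** Integrating over [phi] first turns [g(theta - phi)] into the mean of [g],
whatever [theta] is. *)
Lemma kernel_integral1 t : cintegral mu3 setT (fun P => kernel (P, t)) =
  ((\1_arc t)%:C * (cintegral mu arc G * (plane_fourier (cis t) * H t))).
Proof.
transitivity ((\1_arc t)%:C * H t * cintegral mu3 setT
  (fun P => u P.1 * plane_wave t P.1 * ((\1_arc P.2)%:C * G (t - P.2)))).
  have := @cintegralZ _ _ _ mu3 setT measurableT ((\1_arc t)%:C * H t)
    (fun P => u P.1 * plane_wave t P.1 * ((\1_arc P.2)%:C * G (t - P.2)))
    (cintegrable_tensor (wave_integrable t) (Gi t)).
  by [].
rewrite (cintegral_tensor (wave_integrable t) (Gi t)) -plane_fourierE.
rewrite -(cintegral_mkcond mu arc (fun s => G (t - s))) cintegral_reflect.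
ring.
Qed.

Lemma kernel_integral2 (f : M2 R -> R[i]) (P : RRR) :
  f (M2_coord P) = u P.1 ->
  cintegral mu setT (fun t => kernel (P, t)) =
  (\1_(@M2_chart R) P)%:C * (f (M2_coord P) * L2_ip (M2_rep a (M2_coord P) g) h).
Proof.
move=> fE; have [Pa|Pa] := pselect (arc P.2); last first.
  rewrite indicE memNset ?mul0r; last by move=> [].
  rewrite (_ : (fun t => _) = fun=> 0).
    by rewrite /cintegral /Rintegral !integral0_eq.
  by apply/funext => t; rewrite /kernel /= [\1_arc P.2]indicE memNset// mul0r !mulr0.
rewrite indicE mem_set ?mul1r//.
pose M t := plane_wave t P.1 * G (t - P.2).
have M2 : square_integrable_on mu arc M.
  have Pb : - pi <= P.2 <= pi.
    by move: Pa; rewrite /circle_arc/= in_itv/= => /andP[-> /ltW ->].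
  have [_ _ s3] := square_integrable_shift (repr g) Pb.
  have ms : measurable_fun setT (fun s : R => s - P.2).
    by apply: measurable_funB => //; exact: measurable_cst.
  have [mMr mMi] : cmeasurable_fun setT M.
    apply: cmeasurableM; last exact: (cmeasurable_comp mG ms).
    by apply: cmeasurable_plane_wave => //; exact: measurable_cst.
  split; [exact: measurable_funTS|exact: measurable_funTS|].
  by under eq_integral do rewrite /M cabsM cabs_plane_wave mul1r.
have MH := @square_integrableM _ (measurableTypeR R) R mu _ (@measurable_arc R) _ _ M2 H2.
transitivity (u P.1 * cintegral mu arc (fun t => M t * H t)).
  rewrite -cintegralZ//; last exact: measurable_arc.
  rewrite [RHS]cintegral_mkcond; apply: eq_cintegral => t _.
  rewrite /kernel /M; cbn [fst snd].
  have -> : (\1_arc P.2 : R)%:C = 1 :> R[i] by rewrite indicE mem_set.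
  ring.
rewrite fE; congr (_ * _); rewrite /L2_ip /M2_rep.
apply: ae_eq_cintegral.
- exact: measurable_arc.
- exact: cintegrable_measurable MH.
- exact: cintegrable_measurable (L2_ip_integrable _ _).
have M2' : square_integrable_on mu arc (fun t =>
    cval (cis (complex.Re (a%:C * cval (cis t) * (M2_coord P).1))) * repr g (circle_div (cis t) (M2_coord P).2)).
  have E : (fun t => cval (cis (complex.Re (a%:C * cval (cis t) * (M2_coord P).1))) * repr g (circle_div (cis t) (M2_coord P).2)) = M.
    by apply/funext => t; rewrite plane_waveE circle_div_cis.
  by rewrite E.
have := @L2_class_ae R (fun x => cval (cis (complex.Re (a%:C * cval x * (M2_coord P).1))) *
  repr g (circle_div x (M2_coord P).2)) M2'.
by apply: filterS => t Ht At; rewrite (Ht At) plane_waveE circle_div_cis.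
Qed.

(** The two orders of integration of the kernel.  The right-hand side is the
matrix coefficient of the rank-one operator [g |-> (int g) F]. *)
Lemma fourier_weak_formula (f : M2 R -> R[i]) :
  (forall P : RRR, f (M2_coord P) = u P.1) ->
  M2_integral (fun m => f m * L2_ip (M2_rep a m g) h) =
  cintegral mu arc G * L2_ip (L2_class plane_fourier) h.
Proof.
move=> fE; rewrite /M2_integral cintegral_mkcond.
transitivity (cintegral mu3 setT (fun P => cintegral mu setT (fun t => kernel (P, t)))).
  transitivity (cintegral mu3 setT (fun P => (\1_(@M2_chart R) P)%:C *
      (f (M2_coord P) * L2_ip (M2_rep a (M2_coord P) g) h))); first by [].
  by apply: eq_cintegral => P _; rewrite (@kernel_integral2 f).
rewrite (cfubini1 kernel_integrable) -(cfubini2 kernel_integrable).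
transitivity (cintegral mu arc (fun t => cintegral mu arc G * (plane_fourier (cis t) * H t))).
  by rewrite [RHS]cintegral_mkcond; apply: eq_cintegral => t _; rewrite kernel_integral1.
have FH := @square_integrableM _ (measurableTypeR R) R mu _ (@measurable_arc R) _ _ plane_fourier_square H2.
rewrite cintegralZ//; last exact: measurable_arc.
congr (_ * _); apply: ae_eq_cintegral.
- exact: measurable_arc.
- exact: cintegrable_measurable FH.
- exact: cintegrable_measurable (L2_ip_integrable _ _).
have := L2_class_ae plane_fourier_square.
by apply: filterS => t Ht At; rewrite (Ht At).
Qed.

End Kernel.

End RotationInvariant.

(** * The Schatten lower bound *)

Section SchattenLowerBound.
Context {R : realType}.
Local Notation mu := (@lebesgue_measure R).
Local Notation arc := (circle_arc R).
Local Notation RR := (measurableTypeR R * measurableTypeR R)%type.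
Local Notation RRR := (RR * measurableTypeR R)%type.
Local Notation ip := (@L2_ip R).
Local Notation e0 := (@fourier_basis R 0).
Local Notation c0 := ((Num.sqrt (2 * pi))^-1 : R).

Lemma c0_gt0 : 0 < c0.
Proof. by rewrite invr_gt0 sqrtr_gt0 two_pi_gt0. Qed.

Lemma constant_square_integrable (z : R[i]) : square_integrable_on mu arc (fun=> z).
Proof.
by apply: (@bounded_square_integrable _ _ (cabs z)) => //; split; exact: measurable_cst.
Qed.

Lemma e0_ae : {ae mu, forall t : R, arc t -> repr e0 (cis t) = c0%:C}.
Proof.
have sq : square_integrable_on mu arc (fun t => c0%:C * cval (cis t) ^ 0).
  by under eq_fun do rewrite expr0z mulr1; exact: constant_square_integrable.
have := @L2_class_ae R (fun x => c0%:C * cval x ^ 0) sq.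
by apply: filterS => t H At; rewrite (H At) expr0z mulr1.
Qed.

Lemma L2_ip_e0 (g : L2S1 R) : ip g e0 = c0%:C * cintegral mu arc (fun t => repr g (cis t)).
Proof.
have gi := square_integrable_cintegrable (L2fun_square (repr g)).
rewrite -cintegralZ//; last exact: measurable_arc.
apply: ae_eq_cintegral.
- exact: measurable_arc.
- exact: cintegrable_measurable (L2_ip_integrable _ _).
- by apply: cintegrable_measurable; apply: cintegrableZ; [exact: measurable_arc|exact: gi].
apply: filterS e0_ae => t H At; rewrite (H At) mulrC.
by rewrite -[Num.conj _]/(conjc _) conjc_real.
Qed.

Lemma hnorm_e0 : hnorm ip e0 = 1.
Proof.
apply/eqP; rewrite -(@eqrXn2 _ 2) ?hnorm_ge0// expr1n (hnorm_sqr L2_inner_product).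
rewrite L2_ip_e0 (_ : cintegral _ _ _ = cintegral mu arc (fun=> c0%:C)); last first.
  apply: ae_eq_cintegral.
  - exact: measurable_arc.
  - exact: square_integrable_cmeasurable (L2fun_square _).
  - exact: square_integrable_cmeasurable (constant_square_integrable _).
  - exact: e0_ae.
rewrite Re_realM /cintegral /= Rintegral_cst; last exact: measurable_arc.
rewrite -[X in fine X]/(mu arc) arc_measure /= mulrA -expr2 exprVn sqr_sqrtr ?ltW ?two_pi_gt0//.
by rewrite mulVf// gt_eqF// two_pi_gt0.
Qed.

Variables (u : RR -> R[i]) (f : M2 R -> R[i]) (a : R).
Hypothesis ui : cintegrable (@plane R) setT u.
Hypothesis fE : forall P : RRR, f (M2_coord P) = u P.1.

Let w : L2S1 R := (c0^-1)%:C *: L2_class (plane_fourier u a).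

Let weakE g h : M2_integral (fun m => f m * ip (M2_rep a m g) h) = ip g e0 * ip w h.
Proof.
rewrite (fourier_weak_formula a ui g h fE) L2_ip_e0 (ipZl L2_inner_product).
have : c0%:C * (c0^-1)%:C = 1 :> R[i] by rewrite -realCM divff// gt_eqF// c0_gt0.
move: (c0%:C) ((c0^-1)%:C) => x y xy.
by rewrite mulrACA xy mul1r.
Qed.

(** The group Fourier transform is selected by its weak characterization, so it
suffices that one bounded operator satisfies it. *)
Lemma M2_fourier_rank_one g h :
  ip (M2_fourier f a g) h = ip g e0 * ip w h.
Proof.
rewrite -weakE /M2_fourier; set P := [set T | _].
suff : P (xget (fun=> 0) P) by case=> _; apply.
apply: xgetPex; exists (fun g => ip g e0 *: w); split; first split.
- by move=> b g1 g2; rewrite (ip_linear L2_inner_product) scalerDl -(scalerA b).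
- exists (hnorm ip w) => v; rewrite (hnormZ L2_inner_product) mulrC.
  apply: ler_wpM2l; first exact: hnorm_ge0.
  by have := cauchy_schwarz L2_inner_product v e0; rewrite hnorm_e0 mulr1.
- by move=> g1 h1; rewrite weakE (ipZl L2_inner_product).
Qed.

(** The Schatten norm is at least the norm of [w], the image of the normalized constant;
Cauchy-Schwarz bounds it below by the component of [w] along that constant. *)
Lemma schatten_ge_mean (q : R) : 0 < q <= 2 ->
  ((cabs (cintegral mu arc (fun t => plane_fourier u a (cis t))) `^ q)%:E <=
   M2_schatten_pow q (M2_fourier f a))%E.
Proof.
move=> q02; have q0 : 0 <= q by case/andP: q02 => /ltW.
apply: le_trans (schatten_rank_one_ge L2_inner_product q02 hnorm_e0 M2_fourier_rank_one).
rewrite lee_fin; apply: ge0_ler_powR; rewrite ?nnegrE ?cabs_ge0 ?hnorm_ge0//.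
have := cauchy_schwarz L2_inner_product w e0; rewrite hnorm_e0 mulr1; apply: le_trans.
have F2 := plane_fourier_square a ui.
rewrite (ipZl L2_inner_product) L2_ip_e0 mulrA -realCM mulVf ?mul1r; last first.
  by rewrite gt_eqF// c0_gt0.
rewrite (_ : cintegral _ _ _ = cintegral mu arc (fun t => repr (L2_class (plane_fourier u a)) (cis t)))//.
apply: ae_eq_cintegral.
- exact: measurable_arc.
- exact: square_integrable_cmeasurable F2.
- exact: square_integrable_cmeasurable (L2fun_square _).
by apply: filterS (L2_class_ae F2) => t H At; rewrite (H At).
Qed.

End SchattenLowerBound.

(** * The Laplace transform of the cosine *)

Section LaplaceKernel.
Context {R : realType}.
Local Notation mu := (@lebesgue_measure R).
Variable tau : R.
Hypothesis tau0 : 0 < tau.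

Definition damping (a : R) : R := a * expR (- (tau * a)).

(** The real part of [1 / (tau + i x)^2], which is the Laplace transform of
[a |-> a cos (a x)] at [tau]. *)
Definition abel_kernel (x : R) : R := (tau ^+ 2 - x ^+ 2) / (tau ^+ 2 + x ^+ 2) ^+ 2.

Let den_gt0 x : 0 < tau ^+ 2 + x ^+ 2.
Proof. by rewrite ltr_wpDr ?sqr_ge0// exprn_gt0. Qed.

Let primitive (x a : R) : R :=
  let D := tau ^+ 2 + x ^+ 2 in
  - (expR (- (tau * a)) * ((a / tau + 1 / tau ^+ 2) +
     (a * tau / D + (tau ^+ 2 - x ^+ 2) / D ^+ 2) * cos (a * x) -
     (a * x / D + 2 * tau * x / D ^+ 2) * sin (a * x))).

Let primitive_derive x a :
  is_derive (a : R) 1 (primitive x) (damping a * (1 + cos (a * x))).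
Proof.
rewrite /primitive /damping.
have := den_gt0 x; set D := tau ^+ 2 + x ^+ 2 => D0.
apply: is_derive_eq; rewrite /GRing.scale /=.
set E := expR _; set C := cos _; set S := sin _.
rewrite /D; field; rewrite ?gt_eqF//.
Qed.

Let primitive_bound x : exists2 M : R, 0 <= M & forall a, 1 <= a -> `|primitive x a| <= M / a.
Proof.
have affine_bound (c d a : R) : 1 <= a -> `|a * c + d| <= a * (`|c| + `|d|).
  move=> a1; rewrite (le_trans (ler_normD _ _))// mulrDr normrM ger0_norm ?(le_trans ler01)//.
  by rewrite lerD2l ler_peMl.
pose D := tau ^+ 2 + x ^+ 2.
pose C := (`|tau^-1| + `|1 / tau ^+ 2|) + (`|tau / D| + `|(tau ^+ 2 - x ^+ 2) / D ^+ 2|) +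
   (`|x / D| + `|2 * tau * x / D ^+ 2|).
have C0 : 0 <= C by rewrite !addr_ge0.
exists (4 / tau ^+ 2 * C); first by rewrite mulr_ge0// divr_ge0// sqr_ge0.
move=> a a1; have a0 : 0 < a by rewrite (lt_le_trans ltr01).
have expb : expR (- (tau * a)) <= 4 / (tau * a) ^+ 2.
  rewrite expRN; have ta : 0 < tau * a by rewrite mulr_gt0.
  rewrite -[leRHS]invf_div lef_pV2 ?posrE ?expR_gt0 ?divr_gt0 ?exprn_gt0//.
  rewrite [in leRHS](splitr (tau * a)) expRD.
  have h := expR_ge1Dx (tau * a / 2).
  nra.
rewrite /primitive normrN normrM ger0_norm ?expR_ge0//.
have -> : 4 / tau ^+ 2 * C / a = 4 / (tau * a) ^+ 2 * (a * C).
  by field; rewrite !gt_eqF.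
apply: ler_pM => //.
apply: (le_trans (ler_normD _ _)); rewrite normrN /C mulrDr.
have cs y : `|cos y| <= 1 :> R by rewrite ler_norml cos_geN1 cos_le1.
have sn y : `|sin y| <= 1 :> R by rewrite ler_norml sin_geN1 sin_le1.
apply: lerD; last first.
  rewrite normrM -[leRHS]mulr1; apply: ler_pM => //.
  by rewrite -mulrA; exact: affine_bound.
rewrite mulrDr; apply: (le_trans (ler_normD _ _)); apply: lerD.
  exact: affine_bound.
rewrite normrM -[leRHS]mulr1; apply: ler_pM => //.
by rewrite -mulrA; exact: affine_bound.
Qed.

Let primitive_cvg x : primitive x a @[a --> +oo%R] --> (0 : R).
Proof.
have [M M0 Mb] := primitive_bound x.
apply/cvgrPdist_lt => e e0; near=> a.
have a1 : 1 <= a by near: a; apply: nbhs_pinfty_ge; exact: num_real.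
rewrite sub0r normrN; apply: (le_lt_trans (Mb _ a1)).
have a0 : 0 < a by rewrite (lt_le_trans ltr01).
rewrite ltr_pdivrMr// -ltr_pdivrMl//.
by near: a; apply: nbhs_pinfty_gt; exact: num_real.
Unshelve. all: by end_near. Qed.

(** Adding 1 to the cosine makes the integrand nonnegative, so that the improper
integral follows from an explicit primitive alone.  The constant part is removed
afterwards by the case [x = 0]. *)
Let integral_1Dcos x :
  (\int[mu]_(a in `[0%R, +oo[) (damping a * (1 + cos (a * x)))%:E =
   (tau ^- 2 + abel_kernel x)%:E)%E.
Proof.
have cP (g dg : R -> R) (gd : forall a, is_derive (a : R) 1 g (dg a)) : continuous g.
  by move=> a; apply/differentiable_continuous/derivable1_diffP; have [] := gd a.
have cf : continuous (fun a => damping a * (1 + cos (a * x))).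
  apply: (cP _ (fun a => expR (- (tau * a)) * (1 - tau * a) * (1 + cos (a * x)) -
    damping a * (x * sin (a * x)))) => a.
  by rewrite /damping; apply: is_derive_eq; rewrite /GRing.scale /=; ring.
have f0 : forall a, 0 <= a -> 0 <= damping a * (1 + cos (a * x)).
  by move=> a a0; rewrite /damping mulr_ge0 ?mulr_ge0 ?expR_ge0//.
have H := ge0_continuous_FTC2y f0 (continuous_subspaceT cf) (@primitive_cvg x).
rewrite H.
- rewrite -EFinB; congr (_%:E); rewrite /primitive /abel_kernel mulr0 oppr0 expR0 !mul0r cos0 sin0.
  by field; rewrite ?gt_eqF.
- by move=> a _; have [] := primitive_derive x a.
- by apply: cvg_at_right_filter; apply: (cP _ _ (primitive_derive x)).
- by move=> a _; rewrite derive1E; have [_] := primitive_derive x a.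
Qed.

(** The damped density extended by 0 to the whole line, the domain on which
Fubini is applied. *)
Definition laplace_kernel (a : R) : R := \1_(`]0%R, +oo[%classic : set R) a * damping a.

Lemma laplace_kernel_ge0 a : 0 <= laplace_kernel a.
Proof.
rewrite /laplace_kernel indicE; case: (boolP (_ \in _)) => [/set_mem/=|_]; last by rewrite mul0r.
by rewrite in_itv/= andbT => a0; rewrite mul1r mulr_ge0 ?expR_ge0// ltW.
Qed.

Let measurable_damping : measurable_fun setT damping.
Proof.
apply: measurable_funM => //; apply: measurableT_comp; first exact: measurable_expR.
by apply: measurable_funN; apply: measurable_funM => //; exact: measurable_cst.
Qed.

Lemma measurable_laplace_kernel : measurable_fun setT laplace_kernel.
Proof.
apply: measurable_funM; last exact: measurable_damping.
by apply: measurable_indic; exact: measurable_itv.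
Qed.

Let measurable_cosl x : measurable_fun setT (fun a : R => cos (a * x)).
Proof.
apply: (measurableT_comp (continuous_measurable_fun (@continuous_cos R))).
by apply: measurable_funM => //; exact: measurable_cst.
Qed.

Let laplace_1Dcos x :
  (\int[mu]_a (laplace_kernel a * (1 + cos (a * x)))%:E = (tau ^- 2 + abel_kernel x)%:E)%E.
Proof.
rewrite -integral_1Dcos -integral_itv_obnd_cbnd; last first.
  apply/measurable_EFinP; apply: measurable_funTS; apply: measurable_funM; last first.
    by apply: measurable_funD => //; exact: measurable_cst.
  exact: measurable_damping.
rewrite [RHS]integral_mkcond; apply: eq_integral => a _.
by rewrite patchE /laplace_kernel indicE; case: ifP => _; rewrite ?mul1r ?mul0r.
Qed.

Lemma integrable_laplace_kernel : mu.-integrable setT (EFin \o laplace_kernel).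
Proof.
have h : mu.-integrable setT (fun a => (laplace_kernel a * (1 + cos (a * 0)))%:E).
  apply/integrableP; split.
    apply/measurable_EFinP; apply: measurable_funM; first exact: measurable_laplace_kernel.
    by apply: measurable_funD => //; exact: measurable_cosl.
  have nE a : `|(laplace_kernel a * (1 + cos (a * 0)))%:E|%E = (laplace_kernel a * (1 + cos (a * 0)))%:E.
    by rewrite gee0_abs// lee_fin mulr_ge0 ?laplace_kernel_ge0.
  by under eq_integral do rewrite nE; rewrite laplace_1Dcos ltry.
apply: (eq_integrable _ _ _ _ (integrableZl measurableT 2^-1 h)) => // a _ /=.
by rewrite mulr0 cos0; congr (_%:E); field.
Qed.

Lemma integrable_laplace_cos x : mu.-integrable setT (EFin \o (fun a => laplace_kernel a * cos (a * x))).
Proof.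
apply: le_integrable integrable_laplace_kernel => //.
  apply/measurable_EFinP; apply: measurable_funM; last exact: measurable_cosl.
  exact: measurable_laplace_kernel.
move=> a _ /=; rewrite lee_fin normrM ler_piMr// ler_norml.
by rewrite cos_geN1 cos_le1.
Qed.

Let laplace_D x : \int[mu]_a laplace_kernel a + \int[mu]_a (laplace_kernel a * cos (a * x)) =
  tau ^- 2 + abel_kernel x.
Proof.
rewrite -RintegralD//; [|exact: integrable_laplace_kernel|exact: integrable_laplace_cos].
rewrite /Rintegral -[RHS]/(fine (tau ^- 2 + abel_kernel x)%:E) -laplace_1Dcos.
by congr fine; apply: eq_integral => a _; rewrite mulrDr mulr1.
Qed.

Lemma integral_laplace_kernel : \int[mu]_a laplace_kernel a = tau ^- 2.
Proof.
have := laplace_D 0.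
under [X in _ + X]eq_Rintegral do rewrite mulr0 cos0 mulr1.
have -> : abel_kernel 0 = tau ^- 2.
  by rewrite /abel_kernel expr0n subr0 addr0; field; rewrite gt_eqF.
set x := \int[mu]_a _; lra.
Qed.

Lemma integral_laplace_cos x :
  \int[mu]_a (laplace_kernel a * cos (a * x)) = abel_kernel x.
Proof. by have := laplace_D x; rewrite integral_laplace_kernel => /addrI. Qed.

End LaplaceKernel.

(** * The angular average of the Abel kernel *)

Section AngularAverage.
Context {R : realType}.
Local Notation mu := (@lebesgue_measure R).
Local Notation arc := (circle_arc R).
Variables (tau x y : R).
Hypothesis tau0 : 0 < tau.

(* [s] is the real part of [e^(it) (x + iy)] and [w] its imaginary part, so
   [s' = - w], [w' = s], and [s^2 + w^2] is constant. *)
Let s (t : R) := cos t * x - sin t * y.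
Let w (t : R) := sin t * x + cos t * y.
Let r2 := x ^+ 2 + y ^+ 2.

Let sw t : s t ^+ 2 + w t ^+ 2 = r2.
Proof.
have := cos2Dsin2 t; rewrite /s /w /r2; move: (cos t) (sin t) => c d cd.
have -> : (c * x - d * y) ^+ 2 + (d * x + c * y) ^+ 2 = (c ^+ 2 + d ^+ 2) * (x ^+ 2 + y ^+ 2) by ring.
by rewrite cd mul1r.
Qed.

Let den_gt0 z : 0 < tau ^+ 2 + z ^+ 2.
Proof. by rewrite ltr_wpDr ?sqr_ge0// exprn_gt0. Qed.

(* A periodic function of [t], so its derivative [dM] has mean 0; [dM] is the
   difference of [tau^2 / (tau^2 + s^2)] and a multiple of the Abel kernel. *)
Let M t := s t * w t / (tau ^+ 2 + s t ^+ 2).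

Let dM t := tau ^+ 2 / (tau ^+ 2 + s t ^+ 2) - (tau ^+ 2 + r2) * abel_kernel tau (s t).

Let M_derive t : is_derive (t : R) 1 M (dM t).
Proof.
have n0 : tau ^+ 2 + s t ^+ 2 != 0 by rewrite gt_eqF.
apply: is_derive_eq.
rewrite /GRing.scale /= /dM /abel_kernel -(sw t) /s /w.
by field.
Qed.

Let continuous_derive (g : R -> R) : (forall t, exists d, is_derive (t : R) 1 g d) -> continuous g.
Proof.
move=> gd t; have [d gdt] := gd t.
by apply/differentiable_continuous/derivable1_diffP; have [] := gdt.
Qed.

Let continuous_dM : continuous dM.
Proof.
apply: continuous_derive => t.
have n0 : tau ^+ 2 + s t ^+ 2 != 0 by rewrite gt_eqF.
have n1 : (tau ^+ 2 + s t ^+ 2) ^+ 2 != 0 by rewrite expf_neq0.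
by eexists; apply: is_derive_eq; reflexivity.
Qed.

Lemma continuous_abel_kernel : continuous (abel_kernel tau).
Proof.
apply: continuous_derive => z.
have n1 : (tau ^+ 2 + z ^+ 2) ^+ 2 != 0 by rewrite expf_neq0// gt_eqF.
by eexists; apply: is_derive_eq; reflexivity.
Qed.

Lemma abel_kernel_bound z : `|abel_kernel tau z| <= tau ^- 2.
Proof.
rewrite /abel_kernel normrM normfV (ger0_norm (sqr_ge0 _)).
rewrite ler_pdivrMr ?exprn_gt0// ler_pdivlMl ?exprn_gt0//.
have d := den_gt0 z; have t2 : 0 < tau ^+ 2 by rewrite exprn_gt0.
have z2 := sqr_ge0 z.
have h : `|tau ^+ 2 - z ^+ 2| <= tau ^+ 2 + z ^+ 2 by rewrite ler_norml; apply/andP; split; lra.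
apply: (@le_trans _ _ (tau ^+ 2 * (tau ^+ 2 + z ^+ 2))); first by rewrite ler_pM2l.
by rewrite expr2 ler_pM2r// lerDl.
Qed.

Let s_continuous : continuous s.
Proof. by apply: continuous_derive => t; eexists; apply: is_derive_eq; reflexivity. Qed.

Let measurable_arcR : measurable (arc : set (measurableTypeR R)). Proof. exact: measurable_itv. Qed.

Lemma abel_arc_integrable : mu.-integrable arc (EFin \o (fun t => abel_kernel tau (s t))).
Proof.
apply: measurable_bounded_integrable => //.
- by rewrite -[X in (X < _)%E]/(mu arc) arc_measure ltry.
- apply: measurable_funTS.
  apply: (measurableT_comp (continuous_measurable_fun continuous_abel_kernel)).
  exact: continuous_measurable_fun.
- exists (tau ^- 2); split; first exact: num_real.
  by move=> B tB t _ /=; apply: (le_trans (abel_kernel_bound _)); exact: ltW.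
Qed.

Let integrable_dM : mu.-integrable arc (EFin \o dM).
Proof.
have ci : mu.-integrable `[(- pi), pi]%classic (EFin \o dM).
  apply: continuous_compact_integrable; first exact: segment_compact.
  exact: continuous_subspaceT continuous_dM.
apply: integrableS ci => //.
by apply: subset_itvl; rewrite bnd_simp.
Qed.

Let integral_dM : \int[mu]_(t in arc) dM t = 0.
Proof.
have pipi : - pi < pi :> R by have := pi_gt0 R; lra.
rewrite /circle_arc Rintegral_itv_bndo_bndc; last first.
  exact: integrable_dM.
rewrite /Rintegral (continuous_FTC2 pipi (continuous_subspaceT continuous_dM) (F := M))//=.
- by rewrite /M /s /w !cosN !sinN !sinpi !oppr0 subrr.
- split.
  + by move=> t _; have [] := M_derive t.
  + apply: cvg_at_right_filter; apply: (continuous_derive (g := M)) => t.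
    by exists (dM t).
  + apply: cvg_at_left_filter; apply: (continuous_derive (g := M)) => t.
    by exists (dM t).
- by move=> t _; rewrite derive1E; have [_] := M_derive t.
Qed.

(** The kernel changes sign, but up to a positive factor and a derivative of a
periodic function it is [tau^2 / (tau^2 + s^2)]. *)
Lemma abel_arc_ge0 : 0 <= \int[mu]_(t in arc) abel_kernel tau (s t).
Proof.
have r20 : 0 < tau ^+ 2 + r2 by rewrite ltr_wpDr ?exprn_gt0// addr_ge0// sqr_ge0.
rewrite -(pmulr_rge0 _ r20) -RintegralZl//; last exact: abel_arc_integrable.
have <- : - (\int[mu]_(t in arc) dM t) + \int[mu]_(t in arc) (tau ^+ 2 / (tau ^+ 2 + s t ^+ 2)) =
   \int[mu]_(t in arc) ((tau ^+ 2 + r2) * abel_kernel tau (s t)).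
  have i1 : mu.-integrable arc (EFin \o (fun t => (tau ^+ 2 + r2) * abel_kernel tau (s t))).
    by have := integrableZl measurable_arcR (tau ^+ 2 + r2) abel_arc_integrable.
  have i2 : mu.-integrable arc (EFin \o dM).
    exact: integrable_dM.
  have -> : \int[mu]_(t in arc) (tau ^+ 2 / (tau ^+ 2 + s t ^+ 2)) =
     \int[mu]_(t in arc) (dM t + (tau ^+ 2 + r2) * abel_kernel tau (s t)).
    by apply: eq_Rintegral => t _; rewrite /dM subrK.
  by rewrite (RintegralD measurable_arcR i2 i1) addKr.
rewrite integral_dM oppr0 add0r Rintegral_ge0// => t _.
by rewrite divr_ge0 ?sqr_ge0// ltW.
Qed.

(** If [s^2 <= tau^2 / 4] the kernel is at least [(12 / 25) tau^-2], of which
[tau^-2 / 4] is kept, and the arc has length at least 4. *)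
Lemma abel_arc_ge : r2 <= (tau / 2) ^+ 2 ->
  tau ^- 2 <= \int[mu]_(t in arc) abel_kernel tau (s t).
Proof.
move=> rt; have t2 : 0 < tau ^+ 2 by rewrite exprn_gt0.
have cst_i : mu.-integrable arc (EFin \o (fun=> 4^-1 / tau ^+ 2)).
  apply: measurable_bounded_integrable => //.
    by rewrite -[X in (X < _)%E]/(mu arc) arc_measure ltry.
  exists `|4^-1 / tau ^+ 2|; split; first exact: num_real.
  by move=> B tB t _ /=; exact: ltW.
apply: (@le_trans _ _ (\int[mu]_(t in arc) (4^-1 / tau ^+ 2))).
  rewrite Rintegral_cst// -[X in fine X]/(mu arc) arc_measure /=.
  have := pi_ge2 R; have : 0 < tau ^- 2 by rewrite invr_gt0.
  by move: (tau ^- 2) => z; nra.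
apply: le_Rintegral => //; first exact: abel_arc_integrable.
move=> t _; rewrite /abel_kernel; have := sw t; have w2 := sqr_ge0 (w t); have s2 := sqr_ge0 (s t).
move=> swt; have {}swt : s t ^+ 2 <= tau ^+ 2 / 4.
  have -> : tau ^+ 2 / 4 = (tau / 2) ^+ 2 by field.
  lra.
rewrite ler_pdivlMr ?exprn_gt0// mulrAC ler_pdivrMr//.
move: (tau ^+ 2) (s t ^+ 2) t2 s2 swt => T S T0 S0 ST.
have : (T + S) ^+ 2 <= (5 / 4 * T) ^+ 2.
  by rewrite ler_pXn2r ?nnegrE//; lra.
have : 0 <= T * (T / 4 - S) by rewrite mulr_ge0 ?subr_ge0// ltW.
nra.
Qed.

End AngularAverage.

(** * Abel means of the averaged transform *)

Section Monotone.
Local Open Scope ereal_scope.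
Context d (T : measurableType d) (R : realType) (mu : {measure set T -> \bar R}).

(** The integral of a nonnegative function is a supremum over the simple functions
below it, hence monotone without any measurability.  The norm of an
operator-valued function is compared with a measurable one in this way. *)
Lemma ge0_le_integral_nomeas (D : set T) (f g : T -> \bar R) :
  (forall x, D x -> 0 <= f x) -> (forall x, D x -> f x <= g x) ->
  \int[mu]_(x in D) f x <= \int[mu]_(x in D) g x.
Proof.
move=> f0 fg; rewrite !ge0_integralE//; last first.
  by move=> x Dx; exact: le_trans (f0 _ Dx) (fg _ Dx).
apply: le_ereal_sup => _ [h hf <-]; exists h => // x.
by apply: (le_trans (hf x)); apply: lee_restrict.
Qed.

End Monotone.

Section Asymptotics.
Context {R : realType}.
Local Notation mu := (@lebesgue_measure R).
Local Notation arc := (circle_arc R).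
Local Notation RR := (measurableTypeR R * measurableTypeR R)%type.
Local Notation QQ := (RR * measurableTypeR R)%type.
Local Notation mu2 := (@plane R).
Local Notation muQ := (product_measure_sf (@plane R) (@lebesgue_measure R)).
Variable beta : R.
Hypothesis beta01 : 0 < beta < 1.

Let beta1 : beta < 1. Proof. by case/andP: beta01. Qed.

Let s (t : R) (p : RR) := cos t * p.1 - sin t * p.2.

(** The real part of the integral over the circle of the Fourier transform of the
weight. *)
Definition mean_fourier (a : R) : R :=
  \int[mu]_(t in arc) \int[mu2]_p (weight beta p * cos (a * s t p)).

Lemma mean_fourier_le_schatten (q a : R) : 0 < q <= 2 ->
  ((`|mean_fourier a| `^ q)%:E <= M2_schatten_pow q (M2_fourier (f_beta beta) a))%E.
Proof.
move=> q02; have q0 : 0 <= q by case/andP: q02 => /ltW.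
have ui := cintegrable_real (integrable_weight beta1).
apply: le_trans (@schatten_ge_mean R (fun p => (weight beta p)%:C) (f_beta beta) a ui _ q q02).
  rewrite lee_fin; apply: ge0_ler_powR; rewrite ?nnegrE ?cabs_ge0//.
  apply: le_trans (Re_le_cabs _); rewrite le_eqVlt; apply/orP; left; apply/eqP.
  have E t : complex.Re (plane_fourier (fun p => (weight beta p)%:C) a (cis t)) =
      \int[mu2]_p (weight beta p * cos (a * s t p)).
    rewrite (plane_fourierE _ a t).
    transitivity (\int[mu2]_p complex.Re ((weight beta p)%:C * plane_wave a t p)); first by [].
    by apply: eq_Rintegral => p _; rewrite Re_realM.
  by rewrite /mean_fourier; congr `|_|; apply: eq_Rintegral => t _; rewrite -E.
by move=> P; exact: f_betaE.
Qed.

(* In this section the points are [((x, y), t)], and in [N] below they are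
   preceded by the frequency [a]. *)
Let W (z : QQ) : R := weight beta z.1 * \1_arc z.2.

Let iW : muQ.-integrable setT (EFin \o W).
Proof.
have [ia _] := @integrable_arc R.
exact: (integrable_tensor (integrable_weight beta1) ia).
Qed.

Let measurable_s : measurable_fun setT (fun z : QQ => s z.2 z.1).
Proof.
have mc : measurable_fun setT (@cos R : measurableTypeR R -> measurableTypeR R).
  exact: continuous_measurable_fun (@continuous_cos R).
have ms : measurable_fun setT (@sin R : measurableTypeR R -> measurableTypeR R).
  exact: continuous_measurable_fun (@continuous_sin R).
apply: measurable_funB; apply: measurable_funM.
- exact: (measurableT_comp mc measurable_snd).
- exact: (measurableT_comp measurable_fst measurable_fst).
- exact: (measurableT_comp ms measurable_snd).
- exact: (measurableT_comp measurable_snd measurable_fst).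
Qed.

Let bounded_integrable d (T : measurableType d) (m : {measure set T -> \bar R})
    (f g : T -> R) (c : R) : m.-integrable setT (EFin \o f) -> measurable_fun setT g ->
  (forall x, `|g x| <= c) -> m.-integrable setT (EFin \o (fun x => f x * g x)).
Proof.
move=> fi mg gc; have := integrableZl measurableT c fi.
apply: le_integrable => //.
  apply/measurable_EFinP; apply: measurable_funM => //.
  exact/measurable_EFinP/(measurable_int m fi).
move=> x _ /=; rewrite lee_fin !normrM mulrC; apply: ler_wpM2r => //.
exact: le_trans (gc x) (ler_norm _).
Qed.

Let cos_bound (x : R) : `|cos x| <= 1. Proof. by rewrite ler_norml cos_geN1 cos_le1. Qed.

Let measurable_cos : measurable_fun setT (@cos R : measurableTypeR R -> measurableTypeR R).
Proof. exact: continuous_measurable_fun (@continuous_cos R). Qed.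

Lemma mean_fourierE a : mean_fourier a = \int[muQ]_z (W z * cos (a * s z.2 z.1)).
Proof.
have ic : muQ.-integrable setT (EFin \o (fun z => W z * cos (a * s z.2 z.1))).
  apply: (@bounded_integrable _ _ muQ W _ 1) => //.
  by apply: (measurableT_comp measurable_cos); apply: measurable_funM => //; exact: measurable_cst.
transitivity (\int[(mu2 \x mu)%E]_z (W z * cos (a * s z.2 z.1))); last by [].
rewrite -(Rintegral_fubini2 ic) /mean_fourier Rintegral_mkcond restrict_indic.
apply: eq_Rintegral => t _ /=.
rewrite -RintegralZl//.
  by apply: eq_Rintegral => p _; rewrite /W mulrCA mulrA.
apply: (@bounded_integrable _ _ mu2 (weight beta) (fun p => cos (a * s t p)) 1) => //.
  exact: integrable_weight.
apply: (measurableT_comp measurable_cos); apply: measurable_funM; first exact: measurable_cst.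
by apply: measurable_funB; apply: measurable_funM => //; exact: measurable_cst.
Qed.

Section Tau.
Variable tau : R.
Hypothesis tau01 : 0 < tau <= 1.

Let tau0 : 0 < tau. Proof. by case/andP: tau01. Qed.

Local Notation k := (laplace_kernel tau).

Let N (z : measurableTypeR R * QQ) : R := (k z.1 * W z.2) * cos (z.1 * s z.2.2 z.2.1).

Let iN : (mu \x muQ)%E.-integrable setT (EFin \o N).
Proof.
apply: (bounded_integrable (c := 1) (integrable_tensor (integrable_laplace_kernel tau0) iW)) => //.
apply: (measurableT_comp measurable_cos); apply: measurable_funM; first exact: measurable_fst.
exact: (measurableT_comp measurable_s measurable_snd).
Qed.

Let N_slice a : \int[muQ]_z N (a, z) = k a * mean_fourier a.
Proof.
rewrite mean_fourierE -RintegralZl//.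
  by apply: eq_Rintegral => z _; rewrite /N mulrA.
apply: (@bounded_integrable _ _ muQ W _ 1) => //.
by apply: (measurableT_comp measurable_cos); apply: measurable_funM => //; exact: measurable_cst.
Qed.

Lemma integrable_damped : mu.-integrable setT (EFin \o (fun a => k a * mean_fourier a)).
Proof.
have := integrable_Rfubini1 iN.
by apply: eq_integrable => // a _ /=; rewrite N_slice.
Qed.

Let Phi (p : RR) := \int[mu]_(t in arc) abel_kernel tau (s t p).

Let iK : (mu2 \x mu)%E.-integrable setT (EFin \o (fun z => W z * abel_kernel tau (s z.2 z.1))).
Proof.
apply: (@bounded_integrable _ _ muQ W _ (tau ^- 2)) => //.
  apply: (measurableT_comp _ measurable_s).
  exact: (continuous_measurable_fun (continuous_abel_kernel tau0)).
by move=> z; exact: abel_kernel_bound.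
Qed.

Let Phi_slice p : \int[mu]_t (W (p, t) * abel_kernel tau (s t p)) = weight beta p * Phi p.
Proof.
rewrite /Phi -RintegralZl//; last 2 first.
- exact: measurable_arc.
- exact: (abel_arc_integrable p.1 p.2 tau0).
rewrite [RHS]Rintegral_mkcond restrict_indic; apply: eq_Rintegral => t _.
by rewrite /W [RHS]mulrCA -mulrA.
Qed.

(** Integrating over the frequency before the plane and the angle replaces the
oscillating cosine by its Laplace transform. *)
Lemma integral_damped : \int[mu]_a (k a * mean_fourier a) = \int[mu2]_p (weight beta p * Phi p).
Proof.
transitivity (\int[mu]_a \int[muQ]_z N (a, z)).
  by apply: eq_Rintegral => a _; rewrite N_slice.
rewrite (Rintegral_fubini1 iN) -(Rintegral_fubini2 iN).
transitivity (\int[muQ]_z (W z * abel_kernel tau (s z.2 z.1))).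
  apply: eq_Rintegral => z _; rewrite -(integral_laplace_cos tau0) -RintegralZl//; last first.
    exact: integrable_laplace_cos.
  by apply: eq_Rintegral => a _; rewrite /N /=; ring.
transitivity (\int[(mu2 \x mu)%E]_z (W z * abel_kernel tau (s z.2 z.1))); first by [].
rewrite -(Rintegral_fubini1 iK); apply: eq_Rintegral => p _.
exact: Phi_slice.
Qed.

(* In this box the norm is at most [sqrt 2 tau / 4 <= tau / 2].  The box omits the
   origin, where [0 `^ (- beta)] is 0 instead of infinite. *)
Let B : set RR := `]0%R, (tau / 4)%R]%classic `*` `]0%R, (tau / 4)%R]%classic.

(** The integrand is nonnegative, and on a box of area [tau^2 / 16] it is at least
[tau^-beta tau^-2]. *)
Lemma integral_damped_ge : tau `^ (- beta) / 16 <= \int[mu]_a (k a * mean_fourier a).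
Proof.
have [b0 b1] := andP beta01; have [t0 t1] := andP tau01.
rewrite integral_damped.
have mB : measurable B by apply: measurableX; exact: measurable_itv.
have BE : mu2 B = (tau ^+ 2 / 16)%:E.
  have E : lebesgue_measure (`]0%R, (tau / 4)%R] : set R) = (tau / 4)%:E.
    by rewrite lebesgue_measure_itv/= lte_fin ifT ?divr_gt0// -EFinB subr0.
  rewrite /B planeX; [|exact: measurable_itv..].
  transitivity ((tau / 4)%:E * (tau / 4)%:E)%E; first by congr (_ * _)%E; exact: E.
  by rewrite -EFinM; congr (_%:E); field.
have i1B : mu2.-integrable setT (EFin \o (\1_B : RR -> R)).
  apply/integrableP; split; first by apply/measurable_EFinP; exact: measurable_indic.
  under eq_integral do rewrite /= ger0_norm//.
  by rewrite integral_indic// setIT -[X in (X < _)%E]/(mu2 B) BE ltry.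
have iB : mu2.-integrable setT (EFin \o (fun p => tau `^ (- beta) / tau ^+ 2 * \1_B p)).
  by have := integrableZl measurableT (tau `^ (- beta) / tau ^+ 2) i1B.
have iPhi : mu2.-integrable setT (EFin \o (fun p => weight beta p * Phi p)).
  by have := integrable_Rfubini1 iK; apply: eq_integrable => // p _ /=; rewrite Phi_slice.
apply: (@le_trans _ _ (\int[mu2]_p (tau `^ (- beta) / tau ^+ 2 * \1_B p))).
  rewrite RintegralZl//.
  rewrite /Rintegral integral_indic// setIT -[X in fine X]/(mu2 B) BE /=.
  rewrite le_eqVlt; apply/orP; left; apply/eqP; field.
  by rewrite gt_eqF.
apply: le_Rintegral => // p _.
have Phi0 : 0 <= Phi p by exact: (abel_arc_ge0 p.1 p.2 tau0).
have [Bp|Bp] := pselect (B p); last first.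
  by rewrite indicE memNset// mulr0 mulr_ge0// weight_ge0.
rewrite indicE mem_set// mulr1.
have [] := Bp; rewrite /= !in_itv/= => /andP[x0 xt] /andP[y0 yt].
have r2 : planar_norm p ^+ 2 <= (tau / 2) ^+ 2 by rewrite planar_norm_sqr; nra.
have rt : planar_norm p <= tau / 2.
  by rewrite -(@ler_pXn2r _ 2) ?nnegrE ?planar_norm_ge0// divr_ge0// ltW.
have rp : 0 < planar_norm p.
  by apply: (lt_le_trans x0); apply: (le_trans (ler_norm _)); have [] := coord_le_planar_norm p.
apply: ler_pM => //; first exact: powR_ge0.
- by rewrite invr_ge0 sqr_ge0.
- rewrite /weight indicE mem_set ?mul1r; last by rewrite /=; lra.
  rewrite !powRN lef_pV2 ?posrE ?powR_gt0//.
  by apply: ge0_ler_powR; rewrite ?nnegrE ?planar_norm_ge0 ?(ltW b0) ?(ltW t0)//; lra.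
- by apply: abel_arc_ge => //; rewrite -planar_norm_sqr.
Qed.

End Tau.

End Asymptotics.

(** * Divergence of the Schatten integral *)

Section Divergence.
Context {R : realType}.
Local Notation mu := (@lebesgue_measure R).
Variables (beta q : R).
Hypotheses (beta01 : 0 < beta < 1) (q12 : 1 < q < 2).

Local Notation S := (fun a => M2_schatten_pow q (M2_fourier (f_beta beta) a)).
Local Notation G := (mean_fourier beta).

Let q02 : 0 < q <= 2. Proof. by case/andP: q12 => q1 q2; apply/andP; split; lra. Qed.

(** Where [g > lam], [|g|^q = g^(q-1) g >= lam^(q-1) (g - lam)].  This trades the
power for an affine function of [g], whose damped integral is under control. *)
Lemma truncated_power_le (lam g : R) : 0 < lam ->
  lam `^ (q - 1) * (g - lam) <= `|g| `^ q.
Proof.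
move=> l0; have [gl|lg] := leP g lam.
  by apply: (@le_trans _ _ 0); rewrite ?powR_ge0// mulr_ge0_le0 ?powR_ge0// subr_le0.
have g0 : 0 < g by rewrite (lt_trans l0).
have [q1 q2] := andP q12.
rewrite gtr0_norm// -(mulr_powRB1 (ltW g0)); last by lra.
rewrite mulrC; apply: ler_pM; rewrite ?powR_ge0 ?subr_ge0 ?(ltW lg)//; first by lra.
by apply: ge0_ler_powR; rewrite ?nnegrE ?(ltW l0) ?(ltW g0) ?(ltW lg)//; lra.
Qed.

(** The damped density [a e^(-tau a)] has mass [tau^-2] and is at most [a]. *)
Lemma damped_mean_le (tau lam : R) : 0 < tau <= 1 -> 0 < lam ->
  ((lam `^ (q - 1) * (\int[mu]_a (laplace_kernel tau a * G a) - lam * tau ^- 2))%:E <=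
   \int[mu]_(a in `]0%R, +oo[) (S a * a%:E))%E.
Proof.
move=> tau01 l0; have tau0 : 0 < tau by case/andP: tau01.
pose h a := lam `^ (q - 1) * (laplace_kernel tau a * G a - lam * laplace_kernel tau a).
have i1 := integrable_damped beta01 tau01.
have i2 := integrable_laplace_kernel tau0.
have i3 : mu.-integrable setT (EFin \o (fun a => lam * laplace_kernel tau a)).
  by have := integrableZl measurableT lam i2.
have i4 : mu.-integrable setT
    (EFin \o (fun a => laplace_kernel tau a * G a - lam * laplace_kernel tau a)).
  by have := integrableB measurableT i1 i3.
have ih : mu.-integrable setT (EFin \o h).
  by have := integrableZl measurableT (lam `^ (q - 1)) i4.
have hE : \int[mu]_a h a =
    lam `^ (q - 1) * (\int[mu]_a (laplace_kernel tau a * G a) - lam * tau ^- 2).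
  rewrite /h (RintegralZl _ measurableT i4) (RintegralB measurableT i1 i3).
  by rewrite (RintegralZl _ measurableT i2) integral_laplace_kernel.
rewrite -hE /Rintegral fineK; last exact: integrable_fin_num ih.
apply: (@le_trans _ _ (\int[mu]_a (Num.max (h a) 0)%:E)%E).
  apply: le_integral => //.
    apply: le_integrable (ih) => //.
      apply/measurable_EFinP; apply: measurable_maxr; last exact: measurable_cst.
      by have /measurable_EFinP := measurable_int mu ih.
    move=> a _ /=; rewrite lee_fin; have [h0|h0] := leP 0 (h a); first by [].
    by rewrite normr0.
  by move=> a _; rewrite lee_fin le_max lexx.
rewrite [leRHS]integral_mkcond; apply: ge0_le_integral_nomeas.
  by move=> a _; rewrite lee_fin le_max lexx orbT.
move=> a _; rewrite patchE; case: ifPn => [/set_mem|/negP ana].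
  rewrite /= in_itv/= andbT => a0.
  have kE : laplace_kernel tau a = damping tau a.
    by rewrite /laplace_kernel indicE mem_set ?mul1r//= in_itv/= a0.
  have ka : damping tau a <= a.
    rewrite /damping ler_piMr// ?(ltW a0)// -expR0 ler_expR oppr_le0.
    by rewrite mulr_ge0// ltW.
  have k0 : 0 <= damping tau a by rewrite mulr_ge0 ?expR_ge0// ltW.
  apply: (@le_trans _ _ ((`|G a| `^ q)%:E * a%:E)%E).
    rewrite -EFinM lee_fin ge_max mulr_ge0 ?powR_ge0 ?(ltW a0)// andbT.
    rewrite /h kE.
    have -> : lam `^ (q - 1) * (damping tau a * G a - lam * damping tau a) =
       lam `^ (q - 1) * (G a - lam) * damping tau a by ring.
    apply: (@le_trans _ _ (`|G a| `^ q * damping tau a)).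
      by apply: ler_wpM2r => //; exact: truncated_power_le.
    by apply: ler_wpM2l => //; exact: powR_ge0.
  by apply: lee_wpmul2r; rewrite ?lee_fin ?(ltW a0)//; exact: mean_fourier_le_schatten.
have -> : h a = 0.
  rewrite /h /laplace_kernel indicE memNset ?mul0r ?mulr0 ?subr0 ?mulr0//.
  by move=> H; apply: ana; apply/mem_set.
by rewrite lee_fin maxxx.
Qed.

(** With [lam = tau^(2/q)] both upper terms are multiples of [tau^(2/q - 2)]; the
inequality [tau^-beta <= 16 (1 + I) tau^(2/q - 2)] fails for small [tau]. *)
Lemma schatten_integral_infty : 2 - 2 / q < beta ->
  (\int[mu]_(a in `]0%R, +oo[) (S a * a%:E) = +oo)%E.
Proof.
move=> bq; have [q1 q2] := andP q12; have [b0 b1] := andP beta01.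
set I := (\int[_]_(_ in _) _)%E.
have I0 : (0 <= I)%E.
  apply: integral_ge0 => a; rewrite /= in_itv/= andbT => a0.
  rewrite mule_ge0 ?lee_fin ?(ltW a0)//.
  apply: le_trans (mean_fourier_le_schatten beta01 a q02).
  by rewrite lee_fin powR_ge0.
apply/eqP; apply/negPn/negP => Ioo.
have If : I \is a fin_num by rewrite ge0_fin_numE// ltey.
pose r := fine I; have r0 : 0 <= r by exact: fine_ge0.
(* [tau^d = c], which makes [16 (1 + r) tau^d] equal to 1/2, while the bounds
   would force it to be at least 1. *)
pose d := beta + 2 / q - 2; have d0 : 0 < d by rewrite /d; lra.
pose c := (32 * (1 + r))^-1; have c0 : 0 < c by rewrite invr_gt0; lra.
pose tau := c `^ d^-1.
have tau0 : 0 < tau by rewrite powR_gt0.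
have tau1 : tau <= 1.
  have one : 1 = 1 `^ d^-1 :> R by rewrite powR1.
  have c1 : c <= 1 by rewrite /c invf_le1; lra.
  rewrite one /tau; apply: ge0_ler_powR; rewrite ?nnegrE//; last exact: ltW.
  by rewrite invr_ge0 ltW.
have tau01 : 0 < tau <= 1 by rewrite tau0.
pose X := tau `^ (2 / q - 2); have X0 : 0 < X by rewrite powR_gt0.
have [lam [l0 lq lt]] : exists lam, [/\ 0 < lam, lam `^ (q - 1) * X = 1 & lam * tau ^- 2 = X].
  exists (tau `^ (2 / q)); split; first by rewrite powR_gt0.
    rewrite -powRrM -powRD; last by rewrite (gt_eqF tau0) implybT.
    by rewrite (_ : _ + _ = 0) ?powRr0//; field; rewrite gt_eqF//; lra.
  rewrite /X powRD; last by rewrite (gt_eqF tau0) implybT.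
  by rewrite powRN -[2 in RHS]/(2%:R) powR_mulrn// ltW.
have := damped_mean_le tau01 l0; rewrite -/I -(fineK If) lee_fin -/r lt.
have := integral_damped_ge beta01 tau01.
set J := \int[mu]_a _ => J1 J2.
have J3 : J <= X * (1 + r).
  have : X * (lam `^ (q - 1) * (J - X)) <= X * r by rewrite ler_pM2l.
  by rewrite mulrA [X * _]mulrC lq mul1r; lra.
have J4 : tau `^ (- beta) <= 16 * (X * (1 + r)) by lra.
have : tau `^ beta * tau `^ (- beta) <= tau `^ beta * (16 * (X * (1 + r))).
  by rewrite ler_pM2l// powR_gt0.
rewrite powRN divff ?gt_eqF ?powR_gt0//.
have -> : tau `^ beta * (16 * (X * (1 + r))) = 16 * (1 + r) * (tau `^ beta * X) by ring.
rewrite /X -powRD; last by rewrite (gt_eqF tau0) implybT.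
rewrite (_ : beta + _ = d); last by rewrite /d; ring.
rewrite /tau -powRrM mulVf ?gt_eqF// powRr1 ?(ltW c0)//.
have -> : 16 * (1 + r) * c = 2^-1 by rewrite /c; field; rewrite gt_eqF//; lra.
lra.
Qed.

End Divergence.

Theorem theorem3p3 (R : realType) :
  (forall beta : R, beta < 1 ->
     M2_square_integrable (f_beta beta) /\ compactly_supported (f_beta beta)) /\
  (forall q : R, 1 < q < 2 ->
     exists2 beta : R, 2 / 3 < beta < 1 &
       (\int[lebesgue_measure]_(a in `]0%R, +oo[)
          (M2_schatten_pow q (M2_fourier (f_beta beta) a) * a%:E) = +oo)%E).
Proof.
split=> [beta b1|q q12].
  by split; [exact: f_beta_square_integrable|exact: f_beta_compactly_supported].
have [q1 q2] := andP q12.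
have m1 : Num.max (2 / 3) (2 - 2 / q) < 1.
  rewrite gt_max; apply/andP; split; first lra.
  have : 1 < 2 / q by rewrite ltr_pdivlMr; lra.
  lra.
have m2 : 2 / 3 <= Num.max (2 / 3) (2 - 2 / q) by rewrite le_max lexx.
have m3 : 2 - 2 / q <= Num.max (2 / 3) (2 - 2 / q) by rewrite le_max lexx orbT.
(* The midpoint of the nonempty interval left to [beta]. *)
exists ((Num.max (2 / 3) (2 - 2 / q) + 1) / 2); first by apply/andP; split; lra.
apply: schatten_integral_infty => //; last by lra.
by apply/andP; split; lra.
Qed.
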